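(* Assume that $\mathbb{E}\big[\sum_{i\in\mathbb{N}_+} y_i^{(0)}(\xi)\log y_i^{(0)}(\xi)\big]$ exists and is non-negative. Then the functional equation $$\phi(\xi,u)=E_\xi\Big[\prod_{i\in\mathbb{N}_+}\phi\big(T\xi,u\,y_i^{(0)}(\xi)\big)\Big]\quad\text{for all }u\ge 0\text{ and }\tau\text{-a.e. }\xi$$ has no solution $\phi$ in $\mathcal{L}_1$.
   Context: Environment. $\mathbb{N}=\{0,1,2,\dots\}$, $\mathbb{N}_+=\{1,2,\dots\}$. The random environment $\xi=(\xi_n)_{n\in\mathbb{N}}$ is an i.i.d. sequence with values in a measurable space $(\Theta,\mathcal{E})$; $\tau$ denotes its law on $(\Theta^{\mathbb{N}},\mathcal{E}^{\otimes\mathbb{N}})$. $T$ is the shift: $T(\xi_0,\xi_1,\dots)=(\xi_1,\xi_2,\dots)$. To each value of $\xi_n$ corresponds (measurably) a distribution $\eta(\xi_n)$ on sequences of non-negative numbers that are ultimately zero. Given $\xi$, for each $n$ the random sequence $\bar Y^{(n)}=(y_1^{(n)}(\xi),y_2^{(n)}(\xi),\dots)$ has law $\eta(\xi_n)$ (so the law of $y^{(0)}_i(\xi)$, $i\in\mathbb{N}_+$, depends only on $\xi_0$). $P_\xi$, $E_\xi$ denote the quenched probability and expectation (given $\xi$). $\mathbb{P}$ is the annealed law, $\int g\,d\mathbb{P}=\int_{\Theta^{\mathbb{N}}}\big(\int g(\xi,y)\,dP_\xi(y)\big)d\tau(\xi)$ for positive measurable $g$, with expectation $\mathbb{E}$.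 Convention: $0\log 0=0$. Standing assumption: for each $n\in\mathbb{N}$ and $\tau$-a.e. $\xi$, $$E_\xi\Big[\sum_{i\in\mathbb{N}_+}y_i^{(n)}(\xi)\Big]=1,\qquad P_\xi\Big[\sum_{i\in\mathbb{N}_+}\mathbf{1}_{\{y_i^{(n)}(\xi)>0\}}<\infty\Big]=1,\qquad \mathbb{E}\log\Big[E_\xi\sum_{i\in\mathbb{N}_+}\mathbf{1}_{\{y_i^{(n)}(\xi)>0\}}\Big]>0 .$$ Class $\mathcal{L}_c$ ($c>0$): the set of functions $\phi(\xi,u)=\int_{[0,\infty)}e^{-ux}\mu_\xi(dx)$, $u\ge 0$, $\xi\in\Theta^{\mathbb{N}}$, where $(\mu_\xi)_{\xi}$ is a (measurable in $\xi$) family of probability distributions on $[0,\infty)$ with $\mathbb{E}\int x\,\mu_\xi(dx)=c$. *)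

(* Defs.v *)
From HB Require Import structures.
From mathcomp Require Import all_boot all_order all_algebra.
From mathcomp Require Import all_classical all_reals all_analysis.
From mathcomp Require Import measurable_realfun.

Set Implicit Arguments.
Unset Strict Implicit.
Unset Printing Implicit Defensive.
Import Order.TTheory GRing.Theory Num.Theory.
Import numFieldNormedType.Exports.

Local Open Scope classical_set_scope.
Local Open Scope ring_scope.
Local Open Scope ereal_scope.

Section sequence_space.
Context (d : measure_display) (T : measurableType d).

Definition cylinders : set (set (nat -> T)) :=
  \bigcup_n preimage_set_system setT (fun x : nat -> T => x n) measurable.

(* T^N with the product sigma-algebra *)
Definition seqspace : Type := nat -> T.

HB.instance Definition _ := Pointed.on seqspace.
HB.instance Definition _ := @isMeasurable.Build (sigma_display cylinders)
  seqspace <<s cylinders >> (@sigma_algebra0 _ setT cylinders)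
  (@sigma_algebraC (nat -> T) cylinders)
  (@sigma_algebra_bigcup _ setT cylinders).

Lemma measurable_coord n : measurable_fun setT (fun x : seqspace => x n).
Proof.
move=> _ A mA; apply: sub_sigma_algebra.
by exists n => //; exists A.
Qed.

Definition env_shift (x : seqspace) : seqspace := fun n => x n.+1.

Definition iid (R : realType) (tau : probability seqspace R) : Prop :=
  (forall (n : nat) (A : set T), measurable A ->
     tau [set x | A (x n)] = tau [set x | A (x 0%N)]) /\
  (forall (n : nat) (A : nat -> set T), (forall i, measurable (A i)) ->
     tau [set x | forall i, (i < n)%N -> A i (x i)] =
     \prod_(i < n) tau [set x | A i (x i)]).

End sequence_space.

(* Non-negative ultimately zero sequences; the terms y_1, y_2, ... of the paper
   are indexed from 0 here and everywhere below. *)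
Definition nneg_ultimately_zero (R : realType) : set (seqspace R) :=
  [set s | (forall i, (0 <= s i)%R) /\ exists N, forall i, (N <= i)%N -> s i = 0%R].

Arguments nneg_ultimately_zero R : clear implicits.

Section annealed.
Context (d d' : measure_display) (X : measurableType d) (Y : measurableType d')
  (R : realType).
Variables (tau : probability X R) (P : R.-pker X ~> Y).

Definition annealed (A : set (X * Y)) : \bar R :=
  \int[tau]_x P x (xsection A x).

Let annealed0 : annealed set0 = 0.
Proof. by apply: integral0_eq => x _; rewrite xsection0 measure0. Qed.

Let annealed_ge0 A : 0 <= annealed A.
Proof. exact: integral_ge0. Qed.

Let measurable_section (A : set (X * Y)) : measurable A ->
  measurable_fun setT (fun x => P x (xsection A x) : \bar R).
Proof.
by move=> mA; apply: (measurable_fun_xsection_finite_kernel P); rewrite inE.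
Qed.

Let annealed_sigma_additive : semi_sigma_additive annealed.
Proof.
move=> A mA tA mbigcup.
suff -> : annealed (\bigcup_n A n) = \sum_(0 <= n <oo) annealed (A n).
  by apply: is_cvg_ereal_nneg_natsum => n _; exact: annealed_ge0.
rewrite /annealed -integral_nneseries//; last by move=> n; exact: measurable_section.
apply: eq_integral => x _; rewrite xsection_bigcup measure_bigcup//.
- by apply: eq_eseriesl => n; rewrite in_setT.
- by move=> n _; exact: measurable_xsection.
- exact: trivIset_xsection.
Qed.

HB.instance Definition _ := isMeasure.Build _ _ _ annealed
  annealed0 annealed_ge0 annealed_sigma_additive.

Let annealed_setT : annealed setT = 1.
Proof.
rewrite /annealed (eq_integral (cst 1)).
  by rewrite integral_cst// mul1e; exact: probability_setT.
by move=> x _; rewrite xsectionE preimage_setT prob_kernel.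
Qed.

HB.instance Definition _ := Measure_isProbability.Build _ _ _ annealed
  annealed_setT.

Import HBNNSimple.

Let integral_annealed_nnsfun (f : {nnsfun (X * Y) >-> R}) :
  \int[annealed]_z (f z)%:E = \int[tau]_x \int[P x]_y (f (x, y))%:E.
Proof.
have mf r : measurable (f @^-1` [set r]) by exact: measurable_funPTI.
have mfx r x : measurable ((fun y => f (x, y)) @^-1` [set r]).
  by have := measurable_xsection x (mf r); rewrite xsectionE.
have inner x : \int[P x]_y (f (x, y))%:E =
    \sum_(r \in range f) r%:E * P x (xsection (f @^-1` [set r]) x).
  under eq_integral do rewrite fimfunE -fsumEFin//.
  rewrite ge0_integral_fsum//; last 2 first.
  - move=> r; apply/measurable_EFinP; apply: measurable_funM => //.
    by apply: measurable_indic; exact: mfx.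
  - by move=> r y _; rewrite EFinM nnfun_muleindic_ge0.
  apply: eq_fsbigr => r _.
  rewrite (integralZl_indic _ (fun r => (fun y => f (x, y)) @^-1` [set r]))//; last first.
    move=> r0; apply/seteqP; split => // y fy.
    have : (f @^-1` [set r]) (x, y) by [].
    by rewrite preimage_nnfun0.
  by rewrite integral_indic// setIT xsectionE.
rewrite [RHS](eq_integral _ _ (fun x _ => inner x)) integralT_nnsfun sintegralE.
rewrite ge0_integral_fsum//; last 2 first.
- by move=> r; apply: measurable_funeM; exact: measurable_section.
- move=> r x _; have [r0|r0] := leP 0%R r; first by rewrite mule_ge0.
  by rewrite preimage_nnfun0// xsection0 measure0 mule0.
apply: eq_fsbigr => r _.
have [r0|r0] := leP 0%R r.
  by rewrite ge0_integralZl//; exact: measurable_section.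
rewrite preimage_nnfun0// measure0 mule0 integral0_eq// => x _.
by rewrite xsection0 measure0 mule0.
Qed.

Lemma integral_annealed (g : X * Y -> \bar R) :
  measurable_fun setT g -> (forall z, 0 <= g z) ->
  \int[annealed]_z g z = \int[tau]_x \int[P x]_y g (x, y).
Proof.
move=> mg g0; pose g_ := nnsfun_approx measurableT mg.
have g_g z : (g_ n z)%:E @[n --> \oo] --> g z by exact: cvg_nnsfun_approx.
have mg_ n : measurable_fun setT (fun z => (g_ n z)%:E) by exact/measurable_EFinP.
have nd z : {homo (fun n => (g_ n z)%:E) : m n / (m <= n)%N >-> m <= n}.
  by move=> m n mn; rewrite lee_fin; exact/lefP/nd_nnsfun_approx.
have mgx n x : measurable_fun setT (fun y => (g_ n (x, y))%:E).
  exact: (measurable_fun_pair2 _ (mg_ n)).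
transitivity (\int[annealed]_z limn (fun n => (g_ n z)%:E)).
  by apply: eq_integral => z _; apply/esym/cvg_lim.
rewrite monotone_convergence//; last by move=> n z _; rewrite lee_fin.
transitivity (\int[tau]_x limn (fun n => \int[P x]_y (g_ n (x, y))%:E)).
  rewrite monotone_convergence//.
  - by congr (limn _); apply/funext => n; exact: integral_annealed_nnsfun.
  - move=> n; apply: (measurable_fun_integral_finite_kernel (fun z => (g_ n z)%:E)) => //.
    by move=> z; rewrite lee_fin.
  - by move=> n x _; apply: integral_ge0 => y _; rewrite lee_fin.
  - move=> x _ m n mn; apply: ge0_le_integral => //.
    + by move=> y _; rewrite lee_fin.
    + by move=> y _; exact: nd.
apply: eq_integral => x _.
rewrite -monotone_convergence//.
- by apply: eq_integral => y _; apply/cvg_lim.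
- by move=> n y _; rewrite lee_fin.
Qed.

End annealed.

(* \int[mu]_x f x is by definition the difference of the integrals of f^\+ and
   f^\-, with the convention oo - oo = -oo; this predicate excludes that case. *)
Definition integral_exists (d : measure_display) (X : measurableType d)
    (R : realType) (mu : {measure set X -> \bar R}) (f : X -> \bar R) : Prop :=
  \int[mu]_x f^\+ x < +oo \/ \int[mu]_x f^\- x < +oo.

(* A function of the environment alone has the same integral under the annealed
   law as under its marginal tau, whence the integral against tau below. *)
Definition class_L (d : measure_display) (Theta : measurableType d)
    (R : realType) (tau : probability (seqspace Theta) R) (c : R)
    (phi : seqspace Theta -> R -> R) : Prop :=
  exists mu : R.-pker (seqspace Theta) ~> R,
    [/\ forall xi, mu xi `[0%R, +oo[%classic = 1,
        \int[tau]_xi \int[mu xi]_(x in `[0%R, +oo[) x%:E = c%:E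
      & forall xi (u : R), (0 <= u)%R ->
          (phi xi u)%:E = \int[mu xi]_(x in `[0%R, +oo[) (expR (- (u * x)))%:E].

(* Main.v *)
Require Import Defs.
From HB Require Import structures.
From mathcomp Require Import all_boot all_order all_algebra.
From mathcomp Require Import all_classical all_reals all_analysis.
From mathcomp Require Import measurable_realfun.
From mathcomp Require Import ring lra.

(** Let q(u) be the mean of 1 - phi(xi, u), g(u) = q(u) / u and W = sum_i y_i.
   Then g decreases from 1 to 0, and since (xi_0, T xi) are independent, the
   functional equation yields q(u) <= E[min(1, sum_i q(u y_i))].
   - If E[W log^+ W] < oo, then dropping the minimum, h(x) = g(e^x) is
     subharmonic for the random walk whose step has law sum_i y_i delta_(log y_i),
     a step of nonnegative mean.  With G a primitive of h, the increment
     J(a) = E[G(a + step) - G(a)] is nondecreasing in a and tends to E[step] >= 0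
     at -oo and to 0 at +oo, so J = 0 = E[step] and, G being concave, the step
     vanishes.  Hence y_i is 0 or 1 and the mean number of positive y_i is 1,
     against the hypothesis on its logarithm.
   - If E[W log^+ W] = oo, the sum of the y_i log y_i may have a mean while the
     individual steps do not.  One compares b(r) = 1 - g(2 e^(-r)) with
     the functions beta_S(r) = k_S E[W (min(log^+ W, S) - r)^+], where k_S is
     such that beta_S <= 1/4: a maximum principle gives b >= beta_S, and
     beta_S -> 1/4 pointwise as S -> oo, whereas b vanishes at +oo. *)

Set Implicit Arguments.
Unset Strict Implicit.
Unset Printing Implicit Defensive.
Import Order.TTheory GRing.Theory Num.Theory.
Import numFieldNormedType.Exports.

Local Open Scope classical_set_scope.
Local Open Scope ring_scope.
Local Open Scope ereal_scope.

(** * Primitives and limits of nonincreasing functions *)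

(** [G] is the integral of [h] from 0. As [h] decreases, [h a] is a supergradient of [G] at [a],
    even where [h] jumps; the sign of [b - a] is immaterial. *)
Lemma concave_primitive (R : realType) (h : R -> R) :
  (forall x y, x <= y -> h y <= h x)%R ->
  exists G : R -> R, forall a b, (G b - G a <= h a * (b - a))%R.
Proof.
move=> hni; pose mu := @lebesgue_measure R.
have ih (a b : R) : mu.-integrable `]a, b] (EFin \o h).
  apply: measurable_bounded_integrable => //.
  - by rewrite /mu /= lebesgue_measure_itv/=; case: ifP => _; rewrite -?EFinD ltry.
  - by apply: nonincreasing_measurable => //; exact: measurable_itv.
  - exists (Num.max `|h a| `|h b|)%R; split; first exact: num_real.
    move=> x /ltW hx y /=; rewrite in_itv/= => /andP[/ltW ay yb].
    apply: le_trans hx; have hya := hni _ _ ay; have hyb := hni _ _ yb.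
    rewrite ler_norml lerNl !le_max (le_trans hya (ler_norm _))/= andbT.
    by apply/orP; right; rewrite -normrN (le_trans _ (ler_norm _))// lerN2.
pose I (a b : R) : R := (\int[mu]_(x in `]a, b]) h x)%R.
have Iadd (a b c : R) : (a <= b)%R -> (b <= c)%R -> I a c = (I a b + I b c)%R.
  move=> ab bc; have := @Rintegral_itvB _ h (BRight a) (BRight c) b (ih a c).
  by rewrite !bnd_simp => /(_ ab bc) E; rewrite /I /mu /= -E addrC subrK.
have I0 (a b : R) : (b <= a)%R -> I a b = 0%R.
  by move=> ba; rewrite /I set_itv_ge ?Rintegral_set0// bnd_simp -leNgt.
have Icst (a b k : R) : (a <= b)%R ->
    (\int[mu]_(x in `]a, b]) (cst k x))%R = (k * (b - a))%R.
  move=> ab; rewrite Rintegral_cst// /mu /= lebesgue_measure_itv/= lte_fin.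
  by case: ltgtP ab => //= -> _; rewrite subrr.
have icst (a b k : R) : mu.-integrable `]a, b] (EFin \o cst k).
  apply: measurable_bounded_integrable => //; last exact: bounded_cst.
  by rewrite /mu /= lebesgue_measure_itv/=; case: ifP => _; rewrite -?EFinD ltry.
have Iub (a b : R) : (a <= b)%R -> (I a b <= h a * (b - a))%R.
  move=> ab; rewrite -Icst//; apply: le_Rintegral => // x /=.
  by rewrite in_itv/= => /andP[/ltW ? _]; exact: hni.
have Ilb (a b : R) : (a <= b)%R -> (h b * (b - a) <= I a b)%R.
  move=> ab; rewrite -Icst//; apply: le_Rintegral => // x /=.
  by rewrite in_itv/= => /andP[_ ?]; exact: hni.
(* At least one of the two intervals is empty, so this is the oriented integral for either sign of
   [x]. *)
exists (fun x => I 0%R x - I x 0%R)%R.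
have dG (a b : R) : (a <= b)%R ->
    (I 0 b - I b 0 - (I 0 a - I a 0))%R = I a b.
  move=> ab; have [a0|/ltW a0] := leP 0%R a.
    rewrite (I0 b 0%R) ?(le_trans a0)// (I0 a 0%R)// !subr0.
    by rewrite (Iadd 0%R a b)// addrAC subrr add0r.
  have [b0|/ltW b0] := leP 0%R b.
    by rewrite (I0 b 0%R)// (I0 0%R a)// subr0 sub0r opprK addrC -Iadd.
  by rewrite (I0 0%R b)// (I0 0%R a)// !sub0r opprK (Iadd a b 0%R)// addrC addrK.
move=> a b; have [ab|/ltW ba] := leP a b; first by rewrite dG// Iub.
by rewrite -opprB dG// -opprB mulrN lerN2 Ilb.
Qed.

Section tails.
Local Open Scope ring_scope.
Context (R : realType) (h : R -> R).
Hypothesis hni : forall x y, x <= y -> h y <= h x.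

Lemma noninc_cvg_pinfty (l : R) : (forall x, l <= h x) ->
  (forall e : R, 0 < e -> exists x, h x < l + e) ->
  forall a, h (a + n%:R) @[n --> \oo] --> l.
Proof.
move=> hl ex a; apply/cvgrPdist_lt => e e0; have [x hx] := ex e e0.
near=> n; rewrite distrC ger0_norm ?subr_ge0// ltrBlDl; apply: le_lt_trans hx.
apply: hni; rewrite -lerBlDl; near: n; exact: nbhs_infty_ger.
Unshelve. all: by end_near. Qed.

Lemma noninc_cvg_ninfty (l : R) : (forall x, h x <= l) ->
  (forall e : R, 0 < e -> exists x, l - e < h x) ->
  forall a, h (a - n%:R) @[n --> \oo] --> l.
Proof.
move=> hl ex a; apply/cvgrPdist_lt => e e0; have [x hx] := ex e e0.
near=> n; rewrite ger0_norm ?subr_ge0// ltrBlDl -ltrBlDr.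
apply: (lt_le_trans hx); apply: hni; rewrite lerBlDl -lerBlDr.
near: n; exact: nbhs_infty_ger.
Unshelve. all: by end_near. Qed.

End tails.

(** * Rigidity for a random walk with nonnegative drift *)

Section rigidity.
Local Open Scope ring_scope.
Context d (Z : measurableType d) (R : realType) (mu : {measure set Z -> \bar R}).
Variables (w X : Z -> R) (h : R -> R).
Hypotheses (mw : measurable_fun setT w) (mX : measurable_fun setT X).
Hypothesis w0 : forall z, 0 <= w z.
Hypothesis w1 : (\int[mu]_z (w z)%:E = 1)%E.
Hypothesis iwX : mu.-integrable setT (EFin \o (fun z => w z * X z)).
Hypothesis EX : 0 <= \int[mu]_z (w z * X z).
Hypothesis hni : forall x y, x <= y -> h y <= h x.
Hypotheses (h0 : forall x, 0 <= h x) (h1 : forall x, h x <= 1).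
Hypothesis h_pinfty : forall e : R, 0 < e -> exists x, h x < e.
Hypothesis h_ninfty : forall e : R, 0 < e -> exists x, 1 - e < h x.
Hypothesis h_sub : forall x, ((h x)%:E <= \int[mu]_z (w z * h (x + X z))%:E)%E.

Let iw : mu.-integrable setT (EFin \o w).
Proof.
apply/integrableP; split; first exact/measurable_EFinP.
under eq_integral do rewrite /= ger0_norm//.
by rewrite w1 ltry.
Qed.

(** Under the density [w], [X] is the step of the walk. The function [J] is squeezed to 0 by its
    monotonicity and its two limits, so the concavity inequality for [G] is almost everywhere an
    equality: [G] has slope [h a] from [a] to [a + X z]. A nonzero [X z] would then carry the value
    of [h] unchanged from far left to far right, against the limits 1 and 0. *)
Lemma subharmonic_rigidity : {ae mu, forall z, w z * X z = 0}.
Proof.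
have [G GP] := concave_primitive hni.
have Gnd x y : x <= y -> G x <= G y.
  move=> xy; rewrite -subr_le0 (le_trans (GP _ _))// mulr_ge0_le0 ?subr_le0//.
have GPl a b : h b * (b - a) <= G b - G a.
  by rewrite -lerN2 opprB (le_trans (GP _ _))// -mulrN opprB.
have mh : measurable_fun setT h by apply: nonincreasing_measurable.
have mG : measurable_fun setT G by apply: nondecreasing_measurable.
pose D a z := w z * (G (a + X z) - G a).
have D_ub a z : D a z <= w z * X z * h a.
  rewrite /D -mulrA ler_wpM2l// (le_trans (GP _ _))// addrAC subrr add0r mulrC//.
have D_lb a z : w z * X z * h (a + X z) <= D a z.
  rewrite /D -mulrA ler_wpM2l// (le_trans _ (GPl _ _))// addrAC subrr add0r mulrC//.
have D_abs a z : `|D a z| <= `|w z * X z|.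
  rewrite /D !normrM ler_wpM2l// ler_norml.
  have := GP a (a + X z); have := GPl a (a + X z).
  rewrite addrAC subrr add0r => A B; apply/andP; split.
    apply: le_trans A; rewrite lerNl -mulrN (le_trans (ler_norm _))//.
    by rewrite normrM normrN ler_piMl// ger0_norm.
  apply: (le_trans B); rewrite (le_trans (ler_norm _))//.
  by rewrite normrM ler_piMl// ger0_norm.
have mD a : measurable_fun setT (D a).
  apply: measurable_funM => //; apply: measurable_funB => //.
  by apply: measurableT_comp => //; exact: measurable_funD.
have iD a : mu.-integrable setT (EFin \o D a).
  apply: (le_integrable _ _ _ iwX) => //; first exact/measurable_EFinP.
  by move=> z _ /=; rewrite lee_fin.
pose J a := \int[mu]_z (D a z).
have whi a : mu.-integrable setT (EFin \o (fun z => w z * h (a + X z))).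
  apply: (le_integrable _ _ _ iw) => //.
    apply/measurable_EFinP; apply: measurable_funM => //.
    by apply: measurableT_comp => //; exact: measurable_funD.
  by move=> z _ /=; rewrite lee_fin normrM ler_piMr// ger0_norm.
have h_subR a : h a <= \int[mu]_z (w z * h (a + X z)).
  have := h_sub a; rewrite /Rintegral => hs.
  by rewrite -lee_fin fineK//; exact: (integrable_fin_num _ (whi a)).
have w1R : \int[mu]_z w z = 1 by rewrite /Rintegral w1.
(* The supergradient [h (a + e + X z)] bounds the increment of [G] from [a + X z] below and [h a]
   bounds the one from [a] above; after integration, subharmonicity at [a + e] concludes. *)
have J_step a (e : R) : 0 <= e -> e * (h (a + e) - h a) <= J (a + e) - J a.
  move=> e0; rewrite /J -RintegralB//.
  rewrite -[h a]mulr1 -w1R -RintegralZl// mulrBr -RintegralZl//; last first.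
    by have := integrableZl measurableT (h a) iw; apply: eq_integrable.
  apply: (@le_trans _ _ (e * (\int[mu]_z (w z * h (a + e + X z))) -
     \int[mu]_z (e * (h a * w z)))).
    by rewrite lerD2r ler_wpM2l.
  rewrite -RintegralZl// -RintegralB//; last 2 first.
  - by have := integrableZl measurableT e (whi (a + e)); apply: eq_integrable.
  - have := integrableZl measurableT (e * h a) iw; apply: eq_integrable => // z _.
    by rewrite /= -!EFinM mulrA.
  apply: le_Rintegral => //.
  - apply: (@eq_integrable _ _ _ mu _ measurableT
      ((fun z => e%:E * (w z * h (a + e + X z))%:E) \- (fun z => (e * h a)%:E * (w z)%:E))%E).
      by move=> z _; rewrite /= -?EFinM -?EFinB -mulrA.
    exact: (integrableB measurableT (integrableZl measurableT e (whi (a + e)))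
      (integrableZl measurableT (e * h a) iw)).
  - exact: (integrableB measurableT (iD (a + e)) (iD a)).
  - move=> z _; rewrite /D -[leRHS]mulrBr.
    have -> : e * (w z * h (a + e + X z)) - e * (h a * w z) =
      w z * (h (a + e + X z) * e - h a * e) by ring.
    rewrite ler_wpM2l//.
    have := GPl (a + X z) (a + e + X z); have := GP a (a + e).
    have -> : a + e + X z - (a + X z) = e by ring.
    have -> : a + e - a = e by ring.
    lra.
(* Summing [J_step] over a grid of mesh [c], the lower bound telescopes to
   [c * (h b - h a) >= - c]. *)
have J_nd a b : a <= b -> J a <= J b.
  move=> ab; apply/ler_addgt0Pr => e e0.
  have [n] : exists n : nat, (b - a) / e < n.+1%:R.
    exists (Num.truncn ((b - a) / e)); exact: truncnS_gt.
  rewrite ltr_pdivrMr// => ne.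
  have chain k c : 0 <= c -> c * (h (a + c *+ k) - h a) <= J (a + c *+ k) - J a.
    move=> c0; elim: k => [|k ih]; first by rewrite mulr0n addr0 !subrr mulr0.
    have := J_step (a + c *+ k) c c0; rewrite -addrA -mulrSr; lra.
  pose c := (b - a) / n.+1%:R.
  have c0 : 0 <= c by rewrite divr_ge0// subr_ge0.
  have cb : a + c *+ n.+1 = b.
    by rewrite /c -mulr_natr divfK ?pnatr_eq0// addrC subrK.
  have := chain n.+1 c c0; rewrite cb.
  have ce : c <= e by rewrite /c ler_pdivrMr// ltW// mulrC.
  have := h0 b; have := h1 a; nra.
(* Dominated convergence: [D_lb] and [D_ub] squeeze the integrand, and [D_abs] dominates it by the
   integrable [w z * X z] in absolute value. *)
have cvgJ (c : nat -> R) (l : R) : h (c n) @[n --> \oo] --> l ->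
    (forall x, h (c n + x) @[n --> \oo] --> l) ->
    J (c n) @[n --> \oo] --> l * \int[mu]_z (w z * X z).
  move=> hc hcx.
  have mlX : measurable_fun setT (fun z => l * (w z * X z)).
    by apply: measurable_funM => //; apply: measurable_funM.
  have [|||||_ _ cvI] := @dominated_convergence _ _ _ mu setT measurableT
    (fun n => EFin \o D (c n)) (EFin \o (fun z => l * (w z * X z)))
    (EFin \o (fun z => `|w z * X z|)).
  - by move=> n; exact/measurable_EFinP.
  - exact/measurable_EFinP.
  - apply: aeW => z _; apply: cvg_EFin; first exact: nearW.
    apply: (@squeeze_cvgr _ _ _ _ (fun n => w z * X z * h (c n + X z))
      (fun n => w z * X z * h (c n))).
    + by apply: nearW => n; rewrite D_lb D_ub.
    + by rewrite /= [l * _]mulrC; apply: cvgM; [exact: cvg_cst|exact: hcx].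
    + by rewrite /= [l * _]mulrC; apply: cvgM; [exact: cvg_cst|exact: hc].
  - exact: integrable_norm.
  - by apply: aeW => z n _; rewrite lee_fin.
  rewrite -RintegralZl//.
  apply: fine_cvg; rewrite fineK//.
  apply: integrable_fin_num => //.
  by have := integrableZl measurableT l iwX; apply: eq_integrable.
have J_le0 a : J a <= 0.
  have ca : h (a + n%:R) @[n --> \oo] --> (0 : R).
    by apply: noninc_cvg_pinfty => // e /h_pinfty[x hx]; exists x; rewrite add0r.
  have cJ : J (a + n%:R) @[n --> \oo] --> (0 : R).
    rewrite -[X in _ --> X](mul0r (\int[mu]_z (w z * X z))); apply: cvgJ => // x.
    rewrite (_ : (fun n => _) = (fun n => h (a + x + n%:R))); last first.
      by apply/funext => n; rewrite addrAC.
    by apply: noninc_cvg_pinfty => // e /h_pinfty[t ht]; exists t; rewrite add0r.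
  rewrite -(cvg_lim (@Rhausdorff R) cJ); apply: limr_ge; first exact: cvgP cJ.
  by apply: nearW => n; apply: J_nd; rewrite lerDl.
have J_geEX a : \int[mu]_z (w z * X z) <= J a.
  have ca : h (a - n%:R) @[n --> \oo] --> (1 : R) by exact: noninc_cvg_ninfty.
  have cJ : J (a - n%:R) @[n --> \oo] --> \int[mu]_z (w z * X z).
    rewrite -[X in _ --> X](mul1r (\int[mu]_z (w z * X z))); apply: cvgJ => // x.
    rewrite (_ : (fun n => _) = (fun n => h (a + x - n%:R))); last first.
      by apply/funext => n; rewrite addrAC.
    exact: noninc_cvg_ninfty.
  rewrite -(cvg_lim (@Rhausdorff R) cJ); apply: limr_le; first exact: cvgP cJ.
  by apply: nearW => n; apply: J_nd; rewrite lerBlDr lerDl.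
have EX0 : \int[mu]_z (w z * X z) = 0.
  by apply/eqP; rewrite eq_le EX andbT (le_trans (J_geEX 0)).
have J0 a : J a = 0.
  by apply/eqP; rewrite eq_le J_le0 -EX0 J_geEX.
(* [D a z] is at most the right-hand side, and both have integral 0, by [J0] and [EX0]. *)
have affine a : {ae mu, forall z, D a z = w z * X z * h a}.
  pose F z := w z * X z * h a - D a z.
  have iwXh : mu.-integrable setT (EFin \o (fun z => w z * X z * h a)).
    exact: (integrableZr measurableT (h a) iwX).
  have iF : mu.-integrable setT (EFin \o F) by exact: (integrableB measurableT iwXh (iD a)).
  have /(ae_eq_integral_abs mu measurableT) : (\int[mu]_z `|(F z)%:E| = 0)%E.
    under eq_integral do rewrite gee0_abs ?lee_fin ?subr_ge0//.
    rewrite -[LHS]fineK; last exact: (integrable_fin_num measurableT iF).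
    rewrite -[fine _]/(\int[mu]_z F z) RintegralB// RintegralZr// EX0.
    by rewrite -/(J a) J0 mul0r subrr.
  move=> /(_ (measurable_int _ iF)); apply: filterS => z /(_ I) [] /eqP.
  by rewrite subr_eq0 => /eqP ->.
(* The exceptional set of [affine] depends on [a], so only countably many [a] are used: grids of
   mesh 1/(k+1) starting at -k. *)
have gridae := ae_foralln (fun k => ae_foralln (fun j => affine (- k%:R + j%:R / k.+1%:R))).
move: gridae; apply: filterS => z grid; apply: contrapT => /eqP.
rewrite mulf_eq0 negb_or => /andP[wz Xz].
have {}grid k j : let a := - k%:R + j%:R / k.+1%:R in
    G (a + X z) - G a = X z * h a.
  by apply: (mulfI wz); rewrite mulrA; exact: grid.
have [x0 hx0] := h_ninfty (e := 2^-1) ltac:(by []).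
have [x1 hx1] := h_pinfty (e := 2^-1) ltac:(by []).
(* [k] serves twice: -k lies to the left of [x0], so [h] exceeds 1/2 there, and the mesh 1/(k+1) is
   smaller than the absolute value of [X z]. *)
pose k := (Num.truncn (Num.max `|x0| (`|X z|^-1))).+1.
have : Num.max `|x0| (`|X z|^-1) < k%:R by exact: truncnS_gt.
rewrite gt_max => /andP[kx0 kX].
pose dl : R := k.+1%:R^-1.
have dl0 : 0 < dl by rewrite invr_gt0.
have dlX : dl < `|X z|.
  rewrite /dl invf_plt ?posrE ?normr_gt0//; apply: lt_trans kX _.
  by rewrite ltr_nat.
(* The chord of [G] from one of the two neighbouring points, with slope the value of [h] at that
   point, is longer than [dl] and passes over the other point. Concavity then forbids [h] to drop
   between them. *)
have step j : h (- k%:R + j%:R * dl) <= h (- k%:R + j.+1%:R * dl).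
  have E0 := grid k j; have E1 := grid k j.+1; rewrite /= -/dl in E0 E1.
  have -> : - k%:R + j.+1%:R * dl = - k%:R + j%:R * dl + dl.
    by rewrite -addrA -[in LHS]natr1 mulrDl mul1r.
  move: E1; have -> : - k%:R + j.+1%:R * dl = - k%:R + j%:R * dl + dl.
    by rewrite -addrA -[in LHS]natr1 mulrDl mul1r.
  move: E0; set a := - k%:R + _ => E0 E1.
  have [Xp|Xn] := ltP 0 (X z).
    rewrite ger0_norm ?(ltW Xp)// in dlX.
    have := GP (a + dl) (a + X z); have := GP a (a + dl); nra.
  have {}Xn : X z < 0 by rewrite lt_neqAle Xz.
  rewrite ltr0_norm// in dlX.
  have := GP (a + dl) a; have := GP a (a + dl + X z); nra.
have grid_nd j : h (- k%:R) <= h (- k%:R + j%:R * dl).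
  elim: j => [|j ih]; first by rewrite mul0r addr0.
  exact: le_trans (step j).
(* After [j.+1] steps the grid has passed [x1], where [h] is below 1/2. *)
pose j := Num.truncn ((`|x1| + k%:R) / dl).
have : (`|x1| + k%:R) / dl < j.+1%:R by exact: truncnS_gt.
rewrite ltr_pdivrMr// => hj.
have : h (- k%:R + j.+1%:R * dl) <= h x1.
  by apply: hni; have := ler_norm x1; lra.
have : h x0 <= h (- k%:R).
  by apply: hni; have := ler_norm (- x0); rewrite normrN; lra.
have := grid_nd j.+1; lra.
Qed.
End rigidity.

(** * The heavy-tailed case: a maximum principle *)

Section heavy_tail.
Local Open Scope ring_scope.
Context d (Z : measurableType d) (R : realType) (mu : {measure set Z -> \bar R}).
(* [V u] stands for [min 1 (\sum_i q (u * y i))]. *)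
Variables (y : nat -> Z -> R) (W f : Z -> R) (q : R -> R) (V : R -> Z -> R).
Hypotheses (mW : measurable_fun setT W) (mf : measurable_fun setT f).
Hypothesis mV : forall u, measurable_fun setT (V u).
Hypothesis y0 : forall i z, 0 <= y i z.
Hypotheses (V0 : forall u z, 0 <= V u z) (V1 : forall u z, V u z <= 1).
Hypothesis finsum : forall z, exists N : nat,
  [/\ W z = \sum_(i < N) y i z,
      f z = \sum_(i < N) y i z * ln (y i z) &
      forall u : R, 0 < u -> V u z <= \sum_(i < N) q (u * y i z)].
Hypothesis W1 : (\int[mu]_z (W z)%:E = 1)%E.
Hypothesis ifn : mu.-integrable setT (EFin \o f^\-).
Hypothesis WlnW : (\int[mu]_z (W z * Num.max (ln (W z)) 0)%:E = +oo)%E.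
Hypotheses (q0 : q 0 = 0) (q_le : forall u : R, 0 < u -> q u <= u).
Hypothesis q_near0 : forall e : R, 0 < e ->
  exists u : R, [/\ 0 < u, u <= 2 & (1 - e) * u < q u].
Hypothesis q_sub : forall u : R, 0 < u -> ((q u)%:E <= \int[mu]_z (V u z)%:E)%E.

Let W0 z : 0 <= W z.
Proof. by have [N [-> _ _]] := finsum z; exact: sumr_ge0. Qed.

Let iW : mu.-integrable setT (EFin \o W).
Proof.
apply/integrableP; split; first exact/measurable_EFinP.
by under eq_integral do rewrite /= ger0_norm//; rewrite W1 ltry.
Qed.

Let iWB (B : Z -> R) (C : R) : measurable_fun setT B -> (forall z, `|B z| <= C) ->
  mu.-integrable setT (EFin \o (fun z => W z * B z)).
Proof.
move=> mB BC; apply: (le_integrable measurableT _ _ (integrableZl measurableT C iW)).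
  by apply/measurable_EFinP; exact: measurable_funM.
move=> z _ /=; have C0 := le_trans (normr_ge0 _) (BC z).
by rewrite lee_fin !normrM (ger0_norm C0) (ger0_norm (W0 z)) mulrC ler_wpM2r.
Qed.

Let L (S : nat) z := Num.min (Num.max (ln (W z)) 0) S%:R.

Let L0 S z : 0 <= L S z.
Proof. by rewrite /L le_min le_max lexx orbT/=. Qed.

Let LS S z : L S z <= S%:R.
Proof. by rewrite /L ge_min lexx orbT. Qed.

Let mL S : measurable_fun setT (L S).
Proof.
apply: measurable_minr => //; apply: measurable_maxr => //.
by apply: measurableT_comp => //; exact: measurable_ln.
Qed.

Let I S := \int[mu]_z (W z * L S z).

Let iWL S : mu.-integrable setT (EFin \o (fun z => W z * L S z)).
Proof. by apply: (@iWB _ S%:R) => // z; rewrite ger0_norm. Qed.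

(** Monotone convergence: the truncated means increase to the infinite integral of [WlnW], although
    each of them is finite. *)
Let I_unbounded (M : R) : exists S, M <= I S.
Proof.
have /cvgeyPge /(_ M) : (\int[mu]_z (W z * L S z)%:E)%E @[S --> \oo] --> +oo%E.
  rewrite -WlnW.
  under eq_integral => z _.
    have <- : limn (fun S => (W z * L S z)%:E) = (W z * Num.max (ln (W z)) 0)%:E.
      apply/cvg_lim => //; apply: cvg_EFin; first exact: nearW.
      apply: cvg_near_cst; near=> S; congr (_ * _); rewrite /L; apply/min_idPl.
      near: S; exact: nbhs_infty_ger.
    over.
  apply: cvg_monotone_convergence => //.
  - by move=> n; apply/measurable_EFinP; exact: measurable_funM.
  - by move=> n z _; rewrite lee_fin mulr_ge0.
  - move=> z _ m n mn; rewrite lee_fin ler_wpM2l// /L le_min ge_min lexx/=.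
    by rewrite ge_min ler_nat mn orbT.
move=> [S _ /(_ S (leqnn _))]; exists S.
rewrite -lee_fin /I /Rintegral fineK//.
by apply: (integrable_fin_num _ (iWL S)).
Unshelve. all: by end_near. Qed.

Let v := \int[mu]_z (f^\- z).

Let v0 : 0 <= v.
Proof. by apply: Rintegral_ge0 => z _; rewrite funrneg_ge0. Qed.

Let T (r : R) (S : nat) (z : Z) : R := (r < L S z)%R%:R.

Let mT r S : measurable_fun setT (T r S).
Proof.
rewrite /T; apply: (@measurableT_comp _ _ _ _ _ _ (fun b : bool => b%:R : R)) => //.
exact: measurable_fun_ltr.
Qed.

Let T01 r S z : 0 <= T r S z <= 1.
Proof. by rewrite /T; case: (_ < _); rewrite ?lexx ?ler01. Qed.

(** With u = 2 e^(-r), the event W > e^r reads u W > 2, so there the bound [V u z <= 1] is less than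
    half of u W. This is the purpose of the factor 2. *)
Let b r := 1 - q (2 * expR (- r)) / (2 * expR (- r)).

(* The constant makes both [beta] and [kap S * v] at most 1/4. *)
Let kap S := (4 * (I S + v + 1))^-1.

Let H r S z := Num.max (L S z - r) 0.

Let mH r S : measurable_fun setT (H r S).
Proof. by apply: measurable_maxr => //; exact: measurable_funB. Qed.

Let H0 r S z : 0 <= H r S z.
Proof. by rewrite /H le_max lexx orbT. Qed.

Let H_le r S z : 0 <= r -> H r S z <= L S z.
Proof. by move=> r0; rewrite /H ge_max L0 lerBlDr lerDl r0. Qed.

Let iWH r S : 0 <= r -> mu.-integrable setT (EFin \o (fun z => W z * H r S z)).
Proof.
move=> r0; apply: (@iWB _ S%:R) => // z.
by rewrite ger0_norm// (le_trans (H_le _ _ r0)).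
Qed.

Let iWT r S : mu.-integrable setT (EFin \o (fun z => W z * T r S z)).
Proof.
apply: (@iWB _ 1) => // z.
by case/andP: (T01 r S z) => ? ?; rewrite ger0_norm.
Qed.

Let beta r S := kap S * \int[mu]_z (W z * H r S z).
Let P r S := \int[mu]_z (W z * T r S z).

Let W1R : \int[mu]_z W z = 1.
Proof. by rewrite /Rintegral W1. Qed.

Let IS0 S : 0 <= I S.
Proof. by apply: Rintegral_ge0 => z _; exact: mulr_ge0. Qed.

Let kap0 S : 0 < kap S.
Proof. by rewrite /kap invr_gt0; have := IS0 S; have := v0; lra. Qed.

Let kapE S : kap S * (I S + v + 1) = 4^-1.
Proof.
rewrite /kap invfM -mulrA mulVf ?mulr1// gt_eqF//.
by have := IS0 S; have := v0; lra.
Qed.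

Let P01 r S : 0 <= P r S <= 1.
Proof.
apply/andP; split.
  by apply: Rintegral_ge0 => z _; rewrite mulr_ge0//; case/andP: (T01 r S z).
rewrite -W1R; apply: le_Rintegral => // z _.
by rewrite ler_piMr//; case/andP: (T01 r S z).
Qed.

Let beta_le r S : 0 <= r -> beta r S <= 4^-1.
Proof.
move=> r0; have : \int[mu]_z (W z * H r S z) <= I S.
  by apply: le_Rintegral => //; [exact: iWH|move=> z _; rewrite ler_wpM2l// H_le].
rewrite /beta -(kapE S) => HI; rewrite ler_pM2l//; have := v0; lra.
Qed.

(** [beta] is convex in [r], being an average of the convex functions [H], and [- (kap S * P r S)]
    is a subgradient at [r]. *)
Let beta_supp r r' S : 0 <= r -> 0 <= r' ->
  beta r S - kap S * P r S * (r' - r) <= beta r' S.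
Proof.
move=> r0 r'0; rewrite /beta -mulrA -mulrBr ler_pM2l// -RintegralZr//.
rewrite -RintegralB//; [|exact: iWH|exact: (integrableZr measurableT _ (iWT r S))].
apply: le_Rintegral => //; last 1 first.
- move=> z _; rewrite -mulrA -mulrBr ler_wpM2l// /H /T.
  have [rL|Lr] := ltP r (L S z).
    have -> : Num.max (L S z - r) 0 = L S z - r by apply/max_idPl; rewrite subr_ge0 ltW.
    by rewrite mul1r le_max; apply/orP; left; lra.
  have -> : Num.max (L S z - r) 0 = 0 by apply/max_idPr; rewrite subr_le0.
  by rewrite mul0r subr0 le_max lexx orbT.
- exact: (integrableB measurableT (iWH _ r0) (integrableZr measurableT _ (iWT r S))).
- exact: iWH.
Qed.

(* Where W > e^r the minimum leaves a defect of at least W/2, which pays for the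
   negative drift [v] of the comparison function and shrinks its excess [s]. *)
Let step (S : nat) (s p : R) : 0 <= s -> (forall r, 0 <= r -> r < S%:R -> p <= P r S) ->
  0 <= p <= 1 ->
  (forall r, 0 <= r -> beta r S - s <= b r) ->
  forall r, 0 <= r -> beta r S - s * (1 - p) <= b r.
Proof.
move=> s0 pP /andP[p0 p1] IH r r0.
have u0 : 0 < 2 * expR (- r) by rewrite mulr_gt0// expR_gt0.
have b0 : 0 <= b r.
  by rewrite /b subr_ge0 ler_pdivrMr// mul1r q_le.
have [Sr|rS] := leP S%:R r.
  have -> : beta r S = 0.
    rewrite /beta (_ : (fun z => _) = cst 0) ?Rintegral_cst ?mul0r ?mulr0//.
    apply/funext => z; rewrite /H; apply/eqP; rewrite mulf_eq0; apply/orP; right.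
    by apply/eqP/max_idPr; rewrite subr_le0 (le_trans (LS _ _)).
  by rewrite sub0r (le_trans _ b0)// oppr_le0 mulr_ge0// subr_ge0.
pose u := 2 * expR (- r).
pose m := kap S * P r S.
have m0 : 0 <= m by rewrite mulr_ge0// ?(ltW (kap0 S))//; case/andP: (P01 r S).
(* Where [r < L S z], the coefficient of [W z] is at least (1 - 1/4 + s) - (s + 1/4) = 1/2, and u W
   / 2 already exceeds 1; this fixes the constant [s + 4^-1]. *)
have pt z : V u z <= u * ((1 - beta r S + s) * W z + m * f^\- z -
    (s + 4^-1) * (W z * T r S z)).
  have fn0 : 0 <= f^\- z by exact: funrneg_ge0.
  have fn_ge : - f z <= f^\- z by rewrite /funrneg le_max lexx.
  rewrite /T; have [rL|Lr] := ltP r (L S z).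
    have Wr : expR r < W z.
      have : r < ln (W z).
        move: rL; rewrite /L lt_min lt_max => /andP[/orP[//|r0']] _.
        by rewrite ltNge r0 in r0'.
      move=> rlW; have Wp : 0 < W z.
        rewrite ltNge; apply/negP => /ln0 lW0; rewrite lW0 in rlW.
        by rewrite ltNge r0 in rlW.
      by rewrite -[ltRHS]lnK ?posrE// ltr_expR.
    apply: (le_trans (V1 _ _)).
    have uW : 1 <= u * (W z / 2).
      have -> : u * (W z / 2) = W z * expR (- r) by rewrite /u; field.
      by rewrite expRN ler_pdivlMr ?expR_gt0// mul1r ltW.
    apply: (le_trans uW); rewrite ler_pM2l//.
    rewrite mulr1; have := ler_wpM2r (W0 z) (beta_le S r0).
    by have := mulr_ge0 m0 fn0; have := W0 z; lra.
  (* Here W <= e^r, so every positive [y i z] has [r - ln (y i z) >= 0] and the induction hypothesis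
     applies there. The subgradient line of [beta] turns the shifts into the term [m * f z]. *)
  have [N [WE fE /(_ u u0) Vle]] := finsum z.
  apply: (le_trans Vle).
  have Wr : W z <= expR r.
    have [Wp|Wn] := ltP 0 (W z); last by rewrite (le_trans Wn)// expR_ge0.
    rewrite -[leLHS]lnK ?posrE// ler_expR.
    by move: Lr; rewrite /L ge_min [S%:R <= r]leNgt rS orbF ge_max => /andP[].
  have -> : u * ((1 - beta r S + s) * W z + m * f^\- z - (s + 4^-1) * (W z * 0)) =
     u * ((1 - beta r S + s) * W z + m * f^\- z) by ring.
  apply: (@le_trans _ _ (u * ((1 - beta r S + s) * W z - m * f z))); last first.
    by rewrite ler_pM2l//; nra.
  rewrite WE fE !mulr_sumr -sumrB mulr_sumr; apply: ler_sum => i _.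
  have := y0 i z; rewrite le_eqVlt => /predU1P[<-|yi0].
    by rewrite mulr0 q0 !mul0r !mulr0 subrr mulr0.
  have yir : ln (y i z) <= r.
    rewrite -ler_expR lnK ?posrE//; apply: le_trans Wr; rewrite WE (bigD1 i)//=.
    by rewrite lerDl sumr_ge0.
  have r'0 : 0 <= r - ln (y i z) by rewrite subr_ge0.
  have uyE : 2 * expR (- (r - ln (y i z))) = u * y i z.
    by rewrite opprB addrC expRD lnK ?posrE// mulrA.
  have := IH _ r'0; rewrite /b uyE => IHi.
  have := le_trans (lerB (beta_supp S r0 r'0) (lexx s)) IHi.
  rewrite -/m lerBrDl -lerBrDr ler_pdivrMr; last exact: mulr_gt0.
  by move=> h; apply: (le_trans h); rewrite le_eqVlt; apply/orP; left; apply/eqP; ring.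
have iF : mu.-integrable setT (EFin \o (fun z => u * ((1 - beta r S + s) * W z +
    m * f^\- z - (s + 4^-1) * (W z * T r S z)))).
  exact: (integrableZl measurableT u (integrableB measurableT
    (integrableD measurableT (integrableZl measurableT _ iW)
      (integrableZl measurableT _ ifn)) (integrableZl measurableT _ (iWT r S)))).
have iV : mu.-integrable setT (EFin \o V u).
  apply: (le_integrable measurableT _ _ iF); first exact/measurable_EFinP.
  by move=> z _ /=; rewrite lee_fin !ger0_norm// (le_trans _ (pt z)).
have : q u <= u * ((1 - beta r S + s) + m * v - (s + 4^-1) * P r S).
  have : q u <= \int[mu]_z V u z.
    have := q_sub u0; rewrite /Rintegral => hq.
    by rewrite -lee_fin fineK//; exact: (integrable_fin_num _ iV).
  move=> /le_trans; apply.
  rewrite -[X in X + _ * v]mulr1 -[X in _ * X + _ * v]W1R /v /P -!RintegralZl//.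
  have i1 : mu.-integrable setT (EFin \o (fun z => (1 - beta r S + s) * W z)).
    exact: (integrableZl measurableT _ iW).
  have i2 : mu.-integrable setT (EFin \o (fun z => m * f^\- z)).
    exact: (integrableZl measurableT _ ifn).
  have i3 : mu.-integrable setT (EFin \o (fun z => (s + 4^-1) * (W z * T r S z))).
    exact: (integrableZl measurableT _ (iWT r S)).
  have i12 := integrableD measurableT i1 i2.
  have i123 := integrableB measurableT i12 i3.
  rewrite -RintegralD// -RintegralB// -RintegralZl//.
  exact: le_Rintegral.
rewrite -ler_pdivrMl// mulrC => hq.
(* The drift costs at most [P r S] / 4, which the defect pays; what remains of the gain is
   [s * P r S], at least [s * p]. *)
have mv : m * v <= 4^-1 * P r S.
  rewrite /m mulrAC ler_wpM2r//; first by case/andP: (P01 r S).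
  by rewrite -(kapE S) ler_pM2l//; have := IS0 S; lra.
have := ler_wpM2l s0 (pP r r0 rS); rewrite /b -/u; lra.
Qed.

(** Iterating [step] multiplies the excess by [1 - p] each time, so [b] dominates [beta] in the
    limit. At a point [r] with [b r < 1/8], a large [S] makes [beta r S] at least 1/8. *)
Lemma heavy_tail_absurd : False.
Proof.
have [u [u0 u2 hu]] := q_near0 (e := 8^-1) ltac:(by []).
pose r := ln (2 / u).
have r0 : 0 <= r by rewrite ln_ge0// ler_pdivlMr// mul1r.
have br : b r < 8^-1.
  have -> : b r = 1 - q u / u.
    rewrite /b expRN lnK ?posrE ?divr_gt0//.
    by rewrite invf_div mulrCA mulfV ?mulr1.
  by rewrite ltrBlDr -ltrBlDl ltr_pdivlMr.
(* This size of [I S] makes [I S - r] at least half of [I S + v + 1], hence [kap S * (I S - r)] at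
   least 1/8. *)
have [S IS] := I_unbounded (2 * r + v + 1).
(* A further increase of the truncated mean shows that the event S <= ln W has positive weight [p],
   which bounds [P r' S] below for all [r'] in [0, S). *)
have [S' IS'] := I_unbounded (I S + 1).
pose T' z : R := (S%:R <= ln (W z))%R%:R.
have mT' : measurable_fun setT T'.
  apply: (@measurableT_comp _ _ _ _ _ _ (fun b : bool => b%:R : R)) => //.
  apply: measurable_fun_ler => //.
  by apply: measurableT_comp => //; exact: measurable_ln.
have T'01 z : 0 <= T' z <= 1.
  by rewrite /T'; case: (S%:R <= _); rewrite ?lexx ?ler01.
have iT' : mu.-integrable setT (EFin \o (fun z => W z * T' z)).
  apply: (@iWB _ 1) => // z.
  by case/andP: (T'01 z) => ? ?; rewrite ger0_norm.
pose p := \int[mu]_z (W z * T' z).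
have p0 : 0 < p.
  have : I S' - I S <= S'%:R * p.
    rewrite -RintegralB// -RintegralZl//.
    apply: le_Rintegral => //.
    - exact: (integrableB measurableT (iWL S') (iWL S)).
    - exact: (integrableZl measurableT _ iT').
    - move=> z _; rewrite -mulrBr [leRHS]mulrCA ler_wpM2l// /T'.
      have [_|lS] := leP S%:R (ln (W z)).
        by rewrite mulr1; have := LS S' z; have := L0 S z; lra.
      by rewrite mulr0 subr_le0 /L le_min !ge_min lexx/= ge_max ler0n (ltW lS).
  by move=> h; rewrite ltNge; apply/negP => pn; have : 0 <= S'%:R :> R by []; nra.
have p1 : p <= 1.
  rewrite -W1R; apply: le_Rintegral => // z _.
  by rewrite ler_piMr//; case/andP: (T'01 z).
have pP r' : 0 <= r' -> r' < S%:R -> p <= P r' S.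
  move=> _ rS; apply: le_Rintegral => // z _; rewrite ler_wpM2l// /T' /T.
  have [lS|_] := leP S%:R (ln (W z)); last by rewrite ler0n.
  by rewrite /L lt_min rS lt_max (lt_le_trans rS lS).
(* The induction starts with excess 1, since [beta] is at most 1/4 and [b] is nonnegative. *)
have iter n : forall r, 0 <= r -> beta r S - (1 - p) ^+ n <= b r.
  elim: n => [|n ih] t t0.
    have b0 : 0 <= b t.
      by rewrite /b subr_ge0 ler_pdivrMr ?mul1r ?q_le// mulr_gt0// expR_gt0.
    by rewrite expr0; have := beta_le S t0; lra.
  rewrite exprSr; apply: step => //; first by rewrite exprn_ge0// subr_ge0.
  by rewrite (ltW p0).
have : beta r S <= b r.
  rewrite -subr_le0.
  have cv : (1 - p) ^+ n @[n --> \oo] --> (0 : R).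
    by apply: cvg_expr; rewrite ger0_norm ?subr_ge0//; lra.
  rewrite -(cvg_lim (@Rhausdorff R) cv); apply: limr_ge; first exact: cvgP cv.
  by apply: nearW => n; rewrite lerBlDr -lerBlDl iter.
have : kap S * (I S - r) <= beta r S.
  rewrite /beta ler_pM2l// lerBlDr.
  rewrite -[X in _ + X]mul1r -W1R -RintegralZr// -RintegralD//; last 2 first.
  - exact: iWH.
  - exact: (integrableZr measurableT _ iW).
  apply: le_Rintegral => //.
    exact: (integrableD measurableT (iWH _ r0) (integrableZr measurableT _ iW)).
  by move=> z _; rewrite -mulrDr ler_wpM2l// /H -lerBlDr le_max lexx.
have := kapE S; have := kap0 S; have := v0; nra.
Qed.
End heavy_tail.

(** * Series with finitely many nonzero terms *)

Section finite_support.
Local Open Scope ring_scope.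
Context (R : realType).
Implicit Types (a : nat -> R).

Lemma eseries_finsupp_cvg (a : nat -> \bar R) (N : nat) :
  (forall i, (N <= i)%N -> a i = 0%E) ->
  (\sum_(0 <= i < n) a i)%E @[n --> \oo] --> (\sum_(i < N) a i)%E.
Proof.
move=> a0; apply: cvg_near_cst; near=> n.
have Nn : (N <= n)%N by near: n; exact: nbhs_infty_ge.
rewrite (@big_cat_nat _ _ _ N)//= [X in (_ + X)%E]big_nat_cond.
rewrite [X in (_ + X)%E]big1 ?adde0 ?big_mkord//.
by move=> i /andP[/andP[Ni _] _]; exact: a0.
Unshelve. all: by end_near. Qed.

Lemma eseries_finsupp (a : nat -> \bar R) (N : nat) :
  (forall i, (N <= i)%N -> a i = 0%E) ->
  (\sum_(0 <= i <oo) a i = \sum_(i < N) a i)%E.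
Proof. by move=> a0; apply/cvg_lim => //; exact: eseries_finsupp_cvg. Qed.

Lemma eseries_EFin_finsupp a (N : nat) :
  (forall i, (N <= i)%N -> a i = 0) ->
  (\sum_(0 <= i <oo) (a i)%:E = (\sum_(i < N) a i)%:E)%E.
Proof.
move=> a0; rewrite (@eseries_finsupp _ N) ?sumEFin// => i Ni.
by rewrite a0.
Qed.

Lemma integral_count_finsupp a (N : nat) :
  (forall i, (N <= i)%N -> a i = 0) ->
  (\int[counting]_i (a i)%:E = \sum_(0 <= i <oo) (a i)%:E)%E.
Proof.
move=> a0; rewrite integral_count// /summable -nneseries_esumT//.
rewrite (@eseries_finsupp _ N) => [|i /a0 ->]; last by rewrite abse0.
by rewrite (eq_bigr (fun i : 'I_N => (`|a i|)%:E))// sumEFin ltry.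
Qed.

End finite_support.

(** * Measurability of countable families *)

Section countable_families.
Local Open Scope ring_scope.

Lemma measurable_fun_natprod d d' (Z : measurableType d) (Y : measurableType d')
    (F : nat -> Z -> Y) : (forall n, measurable_fun setT (F n)) ->
  measurable_fun setT (fun p : Z * nat => F p.2 p.1).
Proof.
move=> mF _ A mA; rewrite setTI.
rewrite (_ : _ @^-1` A = \bigcup_n ((F n @^-1` A) `*` [set n])).
  apply: bigcupT_measurable => n; apply: measurableX => //.
  by rewrite -[X in measurable X]setTI; exact: mF.
apply/seteqP; split => [[z n] /= ?|[z n] [m _ [/= ? ->]]//].
by exists n.
Qed.

Lemma measurable_eseries_finsupp d (Z : measurableType d) (R : realType)
    (F : nat -> Z -> \bar R) : (forall n, measurable_fun setT (F n)) ->
  (forall z, exists N, forall i, (N <= i)%N -> F i z = 0%E) ->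
  measurable_fun setT (fun z => \sum_(0 <= i <oo) F i z)%E.
Proof.
move=> mF F0; apply: (emeasurable_fun_cvg (fun n z => \sum_(0 <= i < n) F i z)%E).
  by move=> n; exact: emeasurable_sum.
move=> z _; have [N FN] := F0 z.
by rewrite (eseries_finsupp FN); exact: eseries_finsupp_cvg.
Qed.

End countable_families.

(* The library only registers [counting] as a sigma-finite content, whereas
   Fubini's theorem asks for a sigma-finite measure. *)
HB.instance Definition _ (R : realType) :=
  @Measure_isSigmaFinite.Build _ _ _ (@counting _ R) (@sigma_finite_counting R).

(** * The smoothing inequality forces trivial weights *)

Section smoothing.
Local Open Scope ring_scope.
Context d (Z : measurableType d) (R : realType) (mu : probability Z R).
Variables (y : nat -> Z -> R) (q : R -> R).
Hypothesis my : forall i, measurable_fun setT (y i).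
Hypothesis y0 : forall i z, 0 <= y i z.
Hypothesis yfin : forall z, exists N, forall i, (N <= i)%N -> y i z = 0.
Hypothesis mean1 : (\int[mu]_z (\sum_(0 <= i <oo) (y i z)%:E) = 1)%E.
Let f z : \bar R := (\sum_(0 <= i <oo) (y i z * ln (y i z))%:E)%E.
Hypothesis f_exists : integral_exists mu f.
Hypothesis f_ge0 : (0 <= \int[mu]_z f z)%E.
Hypotheses (mq : measurable_fun setT q) (q0 : q 0 = 0).
Hypothesis q_ge0 : forall u : R, 0 < u -> 0 <= q u.
Hypothesis q_le1 : forall u : R, 0 < u -> q u <= 1.
Hypothesis q_le : forall u : R, 0 < u -> q u <= u.
Hypothesis q_noninc : forall u v : R, 0 < u -> u <= v -> q v * u <= q u * v.
Hypothesis q_near0 : forall e : R, 0 < e -> exists2 u : R, 0 < u & (1 - e) * u < q u.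
Hypothesis q_sub : forall u : R, 0 < u ->
  ((q u)%:E <= \int[mu]_z mine 1 (\sum_(0 <= i <oo) (q (u * y i z))%:E))%E.

Let W z := fine (\sum_(0 <= i <oo) (y i z)%:E)%E.

Let mylny i : measurable_fun setT (fun z => y i z * ln (y i z)).
Proof.
apply: measurable_funM => //.
by apply: measurableT_comp => //; exact: measurable_ln.
Qed.

Let finsums z : exists N : nat,
  [/\ forall i, (N <= i)%N -> y i z = 0,
      (\sum_(0 <= i <oo) (y i z)%:E = (W z)%:E)%E, W z = \sum_(i < N) y i z,
      f z = (fine (f z))%:E & fine (f z) = \sum_(i < N) y i z * ln (y i z)].
Proof.
have [N yN] := yfin z; exists N.
have E1 := eseries_EFin_finsupp yN.
have E2 : f z = (\sum_(i < N) y i z * ln (y i z))%:E.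
  by apply: (@eseries_EFin_finsupp _ (fun i => y i z * ln (y i z))) => i /yN ->; rewrite mul0r.
by split; rewrite // ?/W ?E1 ?E2.
Qed.

Let WE z : (\sum_(0 <= i <oo) (y i z)%:E = (W z)%:E)%E.
Proof. by have [N []] := finsums z. Qed.

Let fE z : f z = (fine (f z))%:E.
Proof. by have [N []] := finsums z. Qed.

Let mW : measurable_fun setT W.
Proof.
apply: (measurableT_comp (fine_measurable measurableT)).
apply: measurable_eseries_finsupp; first by move=> i; exact/measurable_EFinP.
by move=> z; have [N yN] := yfin z; exists N => i /yN ->.
Qed.

Let mfe : measurable_fun setT f.
Proof.
apply: measurable_eseries_finsupp; first by move=> i; exact/measurable_EFinP.
by move=> z; have [N yN] := yfin z; exists N => i /yN ->; rewrite mul0r.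
Qed.

Let mf : measurable_fun setT (fine \o f).
Proof. exact: (measurableT_comp (fine_measurable measurableT)). Qed.

Let W0 z : 0 <= W z.
Proof. by have [N [_ _ -> _ _]] := finsums z; exact: sumr_ge0. Qed.

Let W1 : (\int[mu]_z (W z)%:E = 1)%E.
Proof. by rewrite -mean1; apply: eq_integral => z _; rewrite WE. Qed.

Let f_fun : f = EFin \o (fine \o f).
Proof. by apply/funext => z; rewrite fE. Qed.

(** Otherwise the integral of [f] would be -oo, against [f_ge0]. *)
Let fn_lty : (\int[mu]_z f^\- z < +oo)%E.
Proof.
case: f_exists => // fp; rewrite ltNge leye_eq; apply/negP => /eqP fn.
by move: f_ge0; rewrite integralE fn /= addeNy// lt_eqF.
Qed.

Let ifn : mu.-integrable setT (EFin \o (fine \o f)^\-).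
Proof.
apply/integrableP; split; first by apply/measurable_EFinP; exact: measurable_funrneg.
rewrite [in X in (X < _)%E](_ : (fun z => _) = f^\-%E)//.
apply/funext => z; rewrite /= ger0_norm ?funrneg_ge0//.
by rewrite [in RHS]f_fun funerneg.
Qed.

(** As q(u)/u is nonincreasing, 2 may replace a larger [u]. The bound [u <= 2] later makes
    [ln (2 / u)] nonnegative. *)
Let q_near0' (e : R) : 0 < e -> exists u : R, [/\ 0 < u, u <= 2 & (1 - e) * u < q u].
Proof.
move=> e0; have [u u0 qu] := q_near0 e0.
have [u2|u2] := leP u 2; first by exists u.
exists 2; split=> //; have := q_noninc (u := 2) (v := u) ltac:(by []) (ltW u2).
rewrite -(ltr_pM2r u0) => h; apply: lt_le_trans h.
by rewrite mulrAC ltr_pM2r.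
Qed.

Let WlnW_lty : (\int[mu]_z (W z * Num.max (ln (W z)) 0)%:E < +oo)%E.
Proof.
rewrite ltey; apply/eqP => WlnW.
(* The value 0 for [u <= 0] is a default that keeps [V] in [0, 1]: the bounds on [q] concern
   positive arguments only. *)
pose V u z : R := if 0 < u then fine (mine 1 (\sum_(0 <= i <oo) (q (u * y i z))%:E))%E else 0.
have VE u z : 0 < u -> exists N, [/\ forall i, (N <= i)%N -> y i z = 0 &
    (mine 1 (\sum_(0 <= i <oo) (q (u * y i z))%:E))%E
    = (Num.min 1 (\sum_(i < N) q (u * y i z)))%:E].
  move=> u0; have [N yN] := yfin z; exists N; split => //.
  by rewrite (@eseries_EFin_finsupp _ (fun i => q (u * y i z)) N) ?EFin_min//
    => i /yN ->; rewrite mulr0.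
have qge0 u i z : 0 < u -> 0 <= q (u * y i z).
  move=> u0; have := y0 i z; rewrite le_eqVlt => /predU1P[<-|yi0]; first by rewrite mulr0 q0.
  by rewrite q_ge0// mulr_gt0.
apply: (@heavy_tail_absurd _ Z R mu y W (fine \o f) q V) => //.
- move=> u; have [u0|/negbTE u0] := boolP (0 < u); rewrite /V u0; last exact: measurable_cst.
  apply: (measurableT_comp (fine_measurable measurableT)).
  apply: measurable_mine => //.
  apply: measurable_eseries_finsupp; last first.
    by move=> z; have [N yN] := yfin z; exists N => i /yN ->; rewrite mulr0 q0.
  move=> i; apply/measurable_EFinP; apply: measurableT_comp => //.
  exact: measurable_funM.
- move=> u z; rewrite /V; case: ifPn => // u0; have [N [_ ->]] /= := VE u z u0.
  by rewrite le_min ler01 sumr_ge0// => i _; exact: qge0.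
- move=> u z; rewrite /V; case: ifPn => // u0; have [N [_ ->]] /= := VE u z u0.
  by rewrite ge_min lexx.
- move=> z; have [N [yN _ WN _ fN]] := finsums z; exists N; split => // u u0.
  rewrite /V u0 (@eseries_EFin_finsupp _ (fun i => q (u * y i z)) N)
    => [|i /yN ->]; last by rewrite mulr0.
  by rewrite -EFin_min/= ge_min lexx orbT.
- move=> u u0; apply: (le_trans (q_sub u0)); rewrite le_eqVlt; apply/orP; left; apply/eqP.
  apply: eq_integral => z _; rewrite /V u0.
  by have [N [_ ->]] := VE u z u0.
Qed.

(** With the index as a second coordinate, [y i z] becomes a density of total mass 1 on pairs, and
    the law of [ln (y i z)] under it is the step of the walk. *)
Local Notation m := (mu \x counting)%E.

Let tonelli (F : nat -> Z -> R) : (forall i, measurable_fun setT (F i)) ->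
  (forall i z, 0 <= F i z) ->
  (\int[m]_p (F p.2 p.1)%:E = \int[mu]_z \sum_(0 <= i <oo) (F i z)%:E)%E.
Proof.
move=> mF F0.
transitivity (\int[mu]_z fubini_F counting (fun p : Z * nat => (F p.2 p.1)%:E) z)%E.
  apply: fubini_tonelli1; last by move=> p; rewrite lee_fin.
  by apply/measurable_EFinP; exact: measurable_fun_natprod.
by apply: eq_integral => z _; rewrite /fubini_F ge0_integral_count// => i; rewrite lee_fin.
Qed.

Let mylnp : measurable_fun setT (fun p : Z * nat => y p.2 p.1 * ln (y p.2 p.1)).
Proof. exact: (@measurable_fun_natprod _ _ _ _ (fun i z => y i z * ln (y i z))). Qed.

(** Termwise, the absolute value is twice the positive part minus the term itself, and each positive
    part is controlled by [y i z <= W z]. *)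
Let sum_abs_le z : (\sum_(0 <= i <oo) `|(y i z * ln (y i z))%:E| <=
  2%:E * (W z * Num.max (ln (W z)) 0)%:E + f^\- z)%E.
Proof.
have [N [yN _ WN fN fS]] := finsums z.
rewrite (@eseries_EFin_finsupp _ (fun i => `|y i z * ln (y i z)|) N); last first.
  by move=> i /yN ->; rewrite mul0r normr0.
have -> : (f^\- z = ((fine \o f)^\- z)%:E)%E by rewrite [in LHS]f_fun funerneg.
rewrite -EFinM -EFinD lee_fin.
have fn_ge : - fine (f z) <= (fine \o f)^\- z by rewrite /funrneg le_max lexx.
have -> : \sum_(i < N) `|y i z * ln (y i z)| =
    2 * (\sum_(i < N) y i z * Num.max (ln (y i z)) 0) - fine (f z).
  rewrite fS mulr_sumr -sumrB; apply: eq_bigr => i _.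
  rewrite normrM ger0_norm//; have [l0|l0] := leP 0 (ln (y i z)).
    by rewrite ger0_norm//; ring.
  by rewrite ltr0_norm//; ring.
rewrite lerD// ler_pM2l// [in leRHS]WN mulr_suml; apply: ler_sum => i _.
have := y0 i z; rewrite le_eqVlt => /predU1P[<-|yi0]; first by rewrite !mul0r.
rewrite ler_pM2l// ge_max !le_max lexx orbT andbT; apply/orP; left.
have yW : y i z <= W z by rewrite WN (bigD1 i)//= lerDl sumr_ge0.
by rewrite -WN ler_ln ?posrE// (lt_le_trans yi0).
Qed.

Let mWln : measurable_fun setT (fun z => W z * Num.max (ln (W z)) 0).
Proof.
apply: measurable_funM => //; apply: measurable_maxr => //.
by apply: measurableT_comp => //; exact: measurable_ln.
Qed.

Let Wln0 z : 0 <= W z * Num.max (ln (W z)) 0.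
Proof. by rewrite mulr_ge0// le_max lexx orbT. Qed.

Let mabs i : measurable_fun setT (fun z => `|(y i z * ln (y i z))%:E|%E).
Proof.
have mi : measurable_fun setT (fun z => (y i z * ln (y i z))%:E) by exact/measurable_EFinP.
exact: measurableT_comp.
Qed.

Let iyln : m.-integrable setT (EFin \o (fun p : Z * nat => y p.2 p.1 * ln (y p.2 p.1))).
Proof.
apply/(integrable12ltyP mu counting); first exact/measurable_EFinP.
under eq_integral do rewrite ge0_integral_count//=.
apply: (@le_lt_trans _ _ (\int[mu]_z (2%:E * (W z * Num.max (ln (W z)) 0)%:E + f^\- z)))%E.
  apply: ge0_le_integral => //.
  - by move=> z _; apply: nneseries_ge0.
  - by apply: ge0_emeasurable_sum => [i z _ _|i _] //; exact: mabs.
  - apply: emeasurable_funD; last exact: measurable_funeneg.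
    by apply: measurable_funeM; exact/measurable_EFinP.
  - by move=> z _; exact: sum_abs_le.
rewrite ge0_integralD//; last 3 first.
- by move=> z _; rewrite -EFinM lee_fin mulr_ge0.
- by apply: measurable_funeM; exact/measurable_EFinP.
- exact: measurable_funeneg.
apply: lte_add_pinfty; last exact: fn_lty.
rewrite ge0_integralZl_EFin; [|by []|by move=> z _; rewrite lee_fin
  |exact/measurable_EFinP|by []].
by rewrite lte_mul_pinfty.
Qed.

(** With [WlnW_lty] the step is integrable, so [subharmonic_rigidity] applies on the product with
    the counting measure, to h(x) = q(e^x) / e^x. *)
Lemma smoothing_weights_trivial : {ae mu, forall z, forall i, y i z * ln (y i z) = 0}.
Proof.
pose h x := q (expR x) / expR x.
have hni x t : x <= t -> h t <= h x.
  move=> xt; rewrite /h ler_pdivrMr ?expR_gt0// mulrAC ler_pdivlMr ?expR_gt0//.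
  by apply: q_noninc; rewrite ?expR_gt0// ler_expR.
have : {ae m, forall p, y p.2 p.1 * ln (y p.2 p.1) = 0}.
  apply: (@subharmonic_rigidity _ _ R m (fun p => y p.2 p.1) (fun p => ln (y p.2 p.1)) h) => //.
  - exact: measurable_fun_natprod.
  - apply: (@measurable_fun_natprod _ _ _ _ (fun i z => ln (y i z))) => i.
    by apply: measurableT_comp => //; exact: measurable_ln.
  - by rewrite tonelli.
  - rewrite /Rintegral; apply: fine_ge0; rewrite -integral12_prod_meas1//.
    rewrite [leRHS](_ : _ = \int[mu]_z f z)%E//; apply: eq_integral => z _.
    have [N yN] := yfin z; rewrite /fubini_F /=.
    by apply: (@integral_count_finsupp _ (fun i => y i z * ln (y i z)) N)
      => i /yN ->; rewrite mul0r.
  - by move=> x; rewrite /h divr_ge0 ?expR_ge0// q_ge0 ?expR_gt0.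
  - by move=> x; rewrite /h ler_pdivrMr ?expR_gt0// mul1r q_le ?expR_gt0.
  (* Since q <= 1, [h] is at most e / 2 at this point. *)
  - move=> e e0; exists (ln (2 / e)); rewrite /h lnK ?posrE ?divr_gt0//.
    rewrite ltr_pdivrMr ?divr_gt0// mulrCA divff ?gt_eqF// mulr1.
    by rewrite (le_lt_trans (q_le1 _)) ?divr_gt0// ltr1n.
  - move=> e e0; have [u u0 qu] := q_near0 e0; exists (ln u).
    by rewrite /h lnK ?posrE// ltr_pdivlMr.
  - move=> x; have ex0 := expR_gt0 x.
    pose F i z := y i z * h (x + ln (y i z)).
    have mh : measurable_fun setT h by apply: nonincreasing_measurable.
    have mF i : measurable_fun setT (F i).
      have mx : measurable_fun setT (fun z => x + ln (y i z)).
        apply: measurable_funD => //.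
        by apply: measurableT_comp => //; exact: measurable_ln.
      by apply: measurable_funM => //; exact: (measurableT_comp mh mx).
    have F0 i z : 0 <= F i z.
      by rewrite mulr_ge0// /h divr_ge0 ?expR_ge0// q_ge0 ?expR_gt0.
    have qF i z : q (expR x * y i z) = expR x * F i z.
      rewrite /F /h; have := y0 i z; rewrite le_eqVlt => /predU1P[<-|yi0].
        by rewrite mul0r !mulr0 q0.
      rewrite expRD lnK ?posrE//; field.
      by rewrite !gt_eqF.
    rewrite (tonelli mF F0) -(lee_pmul2l (x := (expR x)%:E)) ?lte_fin//.
    rewrite -ge0_integralZl_EFin; [|by []| | |exact: ltW]; last 2 first.
    - by move=> z _; apply: nneseries_ge0 => i _ _; rewrite lee_fin.
    - apply: ge0_emeasurable_sum => i; first by move=> *; rewrite lee_fin.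
      by move=> _; exact/measurable_EFinP.
    have -> : ((expR x)%:E * (h x)%:E = (q (expR x))%:E)%E.
      by rewrite -EFinM /h mulrCA divff ?gt_eqF// mulr1.
    (* Dropping the minimum with 1 leaves exactly the subharmonicity of [h] at [x]. *)
    apply: (le_trans (q_sub ex0)); apply: ge0_le_integral => //.
    - move=> z _; rewrite le_min lee01/=; apply: nneseries_ge0 => i _ _.
      by rewrite lee_fin qF mulr_ge0// ltW.
    - apply: measurable_mine => //.
      apply: ge0_emeasurable_sum => i; first by move=> *; rewrite lee_fin qF mulr_ge0// ltW.
      move=> _; apply/measurable_EFinP; apply: measurableT_comp => //.
      exact: measurable_funM.
    - apply: measurable_funeM.
      apply: ge0_emeasurable_sum => i; first by move=> *; rewrite lee_fin.
      by move=> _; exact/measurable_EFinP.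
    - move=> z _; rewrite ge_min -nneseriesZl; last by move=> i _; rewrite lee_fin.
      apply/orP; right; rewrite le_eqVlt; apply/orP; left; apply/eqP.
      by apply: eq_eseriesr => i _; rewrite qF EFinM.
move=> aem.
(* Passing from almost every pair to almost every [z] and all [i]: the series of absolute values has
   integral 0, so it vanishes almost everywhere. *)
have : (\int[m]_p `|(y p.2 p.1 * ln (y p.2 p.1))%:E| = 0)%E.
  apply/ae_eq_integral_abs => //; first exact/measurable_EFinP.
  by apply: filterS aem => p /= -> _.
rewrite (tonelli (F := fun i z => `|y i z * ln (y i z)|))//; last first.
  by move=> i; apply: measurableT_comp.
move=> I0.
have : ae_eq mu setT (fun z => \sum_(0 <= i <oo) (`|y i z * ln (y i z)|)%:E)%E (cst 0%E).
  apply/ae_eq_integral_abs => //.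
    apply: ge0_emeasurable_sum => i; first by move=> *; rewrite lee_fin.
    by move=> _; apply/measurable_EFinP; apply: measurableT_comp.
  rewrite -[RHS]I0; apply: eq_integral => z _; rewrite gee0_abs//.
  by apply: nneseries_ge0 => i _ _; rewrite lee_fin.
apply: filterS => z /(_ I) /= Sz i; apply/eqP; rewrite -normr_eq0; apply/eqP.
have := nneseries_lim_ge i.+1 (u_ := fun j => (`|y j z * ln (y j z)|)%:E) (m := 0)
  (P := xpredT) (fun j _ _ => ltac:(by rewrite lee_fin)).
rewrite Sz big_nat_recr//= sumEFin -EFinD lee_fin => hi.
apply/eqP; rewrite eq_le normr_ge0 andbT (le_trans _ hi)// lerDr.
exact: sumr_ge0.
Qed.
End smoothing.

(** * The product sigma-algebra on environments *)

Section seqspace_measurability.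
Context d (T : measurableType d).

Lemma measurable_fun_seqspace d' (X : measurableType d') (f : X -> seqspace T) :
  (forall n, measurable_fun setT (fun x => f x n)) -> measurable_fun setT f.
Proof.
move=> mf; apply: (@measurability _ _ X (seqspace T) setT f (@cylinders d T) erefl).
move=> _ [_ [n _ [B mB <-]] <-].
by rewrite setTI setTI; have := mf n measurableT B mB; rewrite setTI.
Qed.

Lemma measurable_env_shift : measurable_fun setT (@env_shift d T).
Proof. by apply: measurable_fun_seqspace => n; exact: measurable_coord. Qed.

Definition env_head (x : seqspace T) : T := x 0%N.

Definition env_split (x : seqspace T) : T * seqspace T := (env_head x, env_shift x).

HB.instance Definition _ := isMeasurableFun.Build _ _ _ _ env_head
  (@measurable_coord d T 0%N).

HB.instance Definition _ := isMeasurableFun.Build _ _ _ _ (@env_shift d T)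
  measurable_env_shift.

Let measurable_env_split : measurable_fun setT env_split.
Proof. by apply: measurable_fun_pair => //; exact: measurable_funP. Qed.

HB.instance Definition _ := isMeasurableFun.Build _ _ _ _ env_split
  measurable_env_split.

(** A pi-system generating the product sigma-algebra. Factors equal to [setT] from [n] on restrict
    finitely many coordinates, and indexing by all of [nat] makes intersections coordinatewise. *)
Definition rectangles : set (set (seqspace T)) :=
  [set C | exists (n : nat) (A : nat -> set T), [/\ forall i, measurable (A i),
     forall i, (n <= i)%N -> A i = setT & C = [set x | forall i, A i (x i)]]].

Lemma rectanglesI : setI_closed rectangles.
Proof.
move=> _ _ [n [A [mA An ->]]] [m [B [mB Bm ->]]].
exists (maxn n m), (fun i => A i `&` B i); split.
- by move=> i; exact: measurableI.
- by move=> i; rewrite geq_max => /andP[ni mi]; rewrite An// Bm// setIT.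
- apply/seteqP; split => x /=; first by move=> [Ax Bx] i; split.
  by move=> ABx; split => i; have [] := ABx i.
Qed.

Lemma measurable_rectangles : @measurable _ (seqspace T) = <<s rectangles >>.
Proof.
apply/seteqP; split.
  apply: smallest_sub; first exact: smallest_sigma_algebra.
  move=> _ [n _ [B mB <-]]; rewrite setTI; apply: sub_sigma_algebra.
  exists n.+1, (fun i => if i == n then B else setT); split.
  - by move=> i; case: ifP.
  - by move=> i ni; rewrite gtn_eqF.
  - apply/seteqP; split => x /=; last by move=> /(_ n); rewrite eqxx.
    by move=> Bx i; case: ifP => // /eqP ->.
apply: smallest_sub; first exact: sigma_algebra_measurable.
move=> _ [n [A [mA _ ->]]].
rewrite [X in measurable X](_ : _ = \bigcap_i ((fun x : seqspace T => x i) @^-1` A i)).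
  apply: bigcapT_measurable => i; rewrite -[X in measurable X]setTI.
  exact: measurable_coord.
by apply/seteqP; split => x /= Ax i; [move=> _|]; apply: Ax.
Qed.

End seqspace_measurability.

(** * Independence of the first coordinate and the shift *)

Section iid_split.
Context d (T : measurableType d) (R : realType) (tau : probability (seqspace T) R).
Hypothesis iid_tau : iid tau.

Lemma iid_rectangle (n : nat) (A : nat -> set T) : (forall i, measurable (A i)) ->
  (forall i, (n <= i)%N -> A i = setT) ->
  tau [set x | forall i, A i (x i)] = \prod_(i < n) tau [set x | A i (x 0%N)].
Proof.
move=> mA An.
rewrite (_ : [set x | _] = [set x | forall i, (i < n)%N -> A i (x i)]); last first.
  apply/seteqP; split => x /=; first by move=> Ax i _.
  by move=> Ax i; have [/Ax//|/An ->] := ltnP i n.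
rewrite iid_tau.2//; apply: eq_bigr => i _.
exact: iid_tau.1.
Qed.

(** For fixed [A] both sides are finite measures of [C]. They agree on rectangles, hence everywhere
    by uniqueness of measures. *)
Lemma iid_splitE (A : set T) (C : set (seqspace T)) : measurable A -> measurable C ->
  distribution tau (@env_split d T) (A `*` C) = distribution tau (@env_head d T) A * tau C.
Proof.
move=> mA mC.
have mhA : measurable (@env_head d T @^-1` A) by exact: measurable_funPTI.
pose m1 := pushforward (mrestr tau mhA) (@env_shift d T).
have tauA0 : (0 <= fine (distribution tau (@env_head d T) A))%R.
  exact/fine_ge0/measure_ge0.
pose m2 := mscale (NngNum tauA0) tau.
have m12 : m1 C = m2 C.
  apply: (measure_unique (@rectangles d T) (fun=> setT)) => //.
  - exact: measurable_rectangles.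
  - exact: rectanglesI.
  - by move=> _; exists 0%N, (fun=> setT); split => //; apply/seteqP; split.
  - exact: bigcup_const.
  - move=> _ [n [B [mB Bn ->]]].
    rewrite /m1 /m2 /pushforward /mrestr /mscale /=.
    (* Requiring the head in [A] and the shift in the rectangle [B] is one rectangle condition, with
       [A] put in front of the factors of [B]. *)
    pose B' i := if i is j.+1 then B j else A.
    rewrite [X in tau X = _](_ : _ = [set x | forall i, B' i (x i)]); last first.
      apply/seteqP; split => x /=; first by move=> [Bx Ax] [|i]; [exact: Ax|exact: Bx].
      by move=> B'x; split => [i|]; [exact: (B'x i.+1)|exact: (B'x 0%N)].
    rewrite (@iid_rectangle n.+1 B'); [|by case|by case].
    rewrite big_ord_recl /= [RHS]/mscale/= fineK; last exact: fin_num_measure.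
    by rewrite (@iid_rectangle n B).
  - move=> _; rewrite /m1 /= /pushforward /mrestr.
    by rewrite preimage_setT setTI (le_lt_trans (probability_le1 tau mhA))// ltry.
move: m12; rewrite /m2 /mscale /= fineK; last exact: fin_num_measure.
by move=> <-; rewrite /m1 /distribution /pushforward /mrestr setIC.
Qed.

(** The pair of head and shift has for law the product of its marginals, the second being [tau]
    again; Tonelli's theorem does the rest. *)
Lemma integral_iid_split (G : T * seqspace T -> \bar R) :
  measurable_fun setT G -> (forall p, 0 <= G p) ->
  \int[tau]_x G (x 0%N, env_shift x) = \int[tau]_x \int[tau]_x' G (x 0%N, x').
Proof.
move=> mG G0.
transitivity (\int[distribution tau (@env_split d T)]_p G p).
  by rewrite ge0_integral_pushforward// preimage_setT.
transitivity (\int[distribution tau (@env_head d T) \x tau]_p G p).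
  apply: eq_measure_integral => A mA _; apply/esym.
  by apply: product_measure_unique => // B C mB mC; exact: iid_splitE.
transitivity (\int[distribution tau (@env_head d T)]_t fubini_F tau G t).
  exact: fubini_tonelli1.
rewrite ge0_integral_pushforward//; last 2 first.
- exact: measurable_fun_fubini_tonelli_F.
- by move=> t _; apply: integral_ge0 => x _.
Qed.

End iid_split.

(** * Comparing integrals of arbitrary functions *)

Section integral_without_measurability.
Context d (T : measurableType d) (R : realType) (mu : {measure set T -> \bar R}).
Implicit Types f g : T -> \bar R.

Import HBNNSimple.

(* Measurability is not assumed because phi is arbitrary at negative arguments,
   which the y_i may produce on a null set. *)
Lemma ae_ge0_le_integral_any f g : (forall x, 0 <= f x) -> (forall x, 0 <= g x) ->
  {ae mu, forall x, f x <= g x} -> \int[mu]_x f x <= \int[mu]_x g x.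
Proof.
move=> f0 g0 [N [mN N0 fgN]]; rewrite [leLHS]ge0_integralTE//.
apply: ge_ereal_sup => _ [h /= hf <-].
have mNC : measurable (~` N) by exact: measurableC.
(* Cutting a simple function below [f] to the complement of the null set keeps its integral and puts
   it below [g] everywhere. *)
have -> : sintegral mu h = sintegral mu (proj_nnsfun h mNC).
  rewrite -!integralT_nnsfun; apply: ae_eq_integral => //.
  - exact/measurable_EFinP.
  - exact/measurable_EFinP.
  exists N; split => // x /= hx; apply: contrapT => Nx; apply: hx => _.
  by rewrite /proj_nnsfun/= mindicE mem_set// mulr1.
rewrite ge0_integralTE//; apply: ereal_sup_ubound.
exists (proj_nnsfun h mNC) => // x; rewrite /proj_nnsfun/= mindicE.
have [|_] := boolP (x \in ~` N); last by rewrite mulr0.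
rewrite inE mulr1 => /= Nx; apply: (le_trans (hf x)).
by apply: contrapT => fg; apply: Nx; exact: fgN.
Qed.

Lemma ae_eq_integral_any f g : {ae mu, forall x, f x = g x} ->
  \int[mu]_x f x = \int[mu]_x g x.
Proof.
move=> fg; rewrite integralE [RHS]integralE; congr (_ - _); apply/eqP;
  rewrite eq_le; apply/andP; split; apply: ae_ge0_le_integral_any => //;
  by apply: filterS fg => x; rewrite !unlock => ->.
Qed.

End integral_without_measurability.

(** * Kernels composed with a measurable map *)

Section pullback_kernel.
Context d d' d'' (X' : measurableType d) (X : measurableType d') (Y : measurableType d'')
  (R : realType) (k : R.-pker X ~> Y) (f : X' -> X).

(** Pulled back along a projection, a kernel integrates functions that carry an additional
    parameter, with a jointly measurable result. *)
Definition kpullback (mf : measurable_fun setT f) : X' -> {measure set Y -> \bar R} :=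
  fun x => k (f x).

Hypothesis mf : measurable_fun setT f.

Let measurable_kpullback U : measurable U ->
  measurable_fun setT (kpullback mf ^~ U).
Proof. by move=> mU; exact: (measurableT_comp (measurable_kernel k U mU) mf). Qed.

HB.instance Definition _ := isKernel.Build _ _ _ _ _ (kpullback mf)
  measurable_kpullback.

Let kpullback_prob x : kpullback mf x [set: Y] = 1.
Proof. exact: prob_kernel. Qed.

HB.instance Definition _ := Kernel_isProbability.Build _ _ _ _ _
  (kpullback mf) kpullback_prob.

End pullback_kernel.

(** * The function 1 - e^(-ux) *)

Section laplace_defect.
Context (R : realType).
Local Open Scope ring_scope.
Implicit Types u v x : R.

(* The positive parts make the complement 1 - e^(-ux) nonnegative for all
   real arguments; only u, x >= 0 matter. *)
Definition laplace_defect u x : R := 1 - expR (- (Num.max u 0 * Num.max x 0)).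

Let max_ge0 u : 0 <= Num.max u 0. Proof. by rewrite le_max lexx orbT. Qed.

Lemma laplace_defectE u x : 0 <= u -> 0 <= x -> laplace_defect u x = 1 - expR (- (u * x)).
Proof.
by move=> u0 x0; rewrite /laplace_defect; do 2 (rewrite (max_idPl _)//).
Qed.

Lemma laplace_defect_ge0 u x : 0 <= laplace_defect u x.
Proof. by rewrite subr_ge0 -expR0 ler_expR oppr_le0 mulr_ge0. Qed.

Lemma laplace_defect_le1 u x : laplace_defect u x <= 1.
Proof. by rewrite gerBl expR_ge0. Qed.

Lemma laplace_defect0 x : laplace_defect 0 x = 0.
Proof. by rewrite /laplace_defect maxxx mul0r oppr0 expR0 subrr. Qed.

Lemma laplace_defect_homo x u v : u <= v -> laplace_defect u x <= laplace_defect v x.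
Proof.
move=> uv; rewrite /laplace_defect lerD2l lerN2 ler_expR lerN2 ler_wpM2r//.
by rewrite ge_max !le_max uv lexx orbT.
Qed.

Lemma laplace_defect_le u x : 0 <= u -> laplace_defect u x <= u * Num.max x 0.
Proof.
move=> u0; rewrite /laplace_defect (max_idPl u0) lerBlDr -lerBlDl.
exact: expR_ge1Dx.
Qed.

(** For t >= 0, e^(-t) <= 1/(1+t) <= 1 - t + t^2. *)
Lemma laplace_defect_ge u x : 0 <= u ->
  u * Num.max x 0 - (u * Num.max x 0) ^+ 2 <= laplace_defect u x.
Proof.
move=> u0; rewrite /laplace_defect (max_idPl u0).
set t := u * _; have t0 : 0 <= t by rewrite mulr_ge0.
have et : 0 < expR t by rewrite expR_gt0.
have := expR_ge1Dx t; rewrite expRN => h.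
have : (expR t)^-1 <= (1 + t)^-1 by rewrite lef_pV2// posrE; lra.
have : (1 + t)^-1 <= 1 - t + t ^+ 2.
  rewrite -[leLHS]mul1r ler_pdivrMr; last lra.
  have : 0 <= t ^+ 3 by rewrite exprn_ge0.
  have -> : (1 - t + t ^+ 2) * (1 + t) = 1 + t ^+ 3 by ring.
  lra.
lra.
Qed.

(** Convexity of the exponential between -vz and 0, with weight u/v: the defect divided by [u] is
    nonincreasing in [u]. *)
Lemma laplace_defect_concave u v x : 0 < u -> u <= v ->
  laplace_defect v x * u <= laplace_defect u x * v.
Proof.
move=> u0 uv; have v0 := lt_le_trans u0 uv.
rewrite /laplace_defect (max_idPl (ltW u0)) (max_idPl (ltW v0)).
set z := Num.max x 0.
have t01 : 0 <= u / v <= 1 by rewrite divr_ge0 ?(ltW u0) ?(ltW v0)//= ler_pdivrMr// mul1r.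
have := @convex_expR R (Itv01 (proj1 (andP t01)) (proj2 (andP t01))) (- (v * z)) 0.
rewrite !convRE /= expR0 mulr0 addr0 mulr1.
have -> : u / v * - (v * z) = - (u * z) by field; rewrite gt_eqF.
rewrite /unstable.onem; set c := u / v => h.
have -> : u = c * v by rewrite /c divfK// gt_eqF.
rewrite mulrA ler_pM2r//; move: h.
have -> : c * v = u by rewrite /c divfK// gt_eqF.
lra.
Qed.

Lemma measurable_laplace_defect : measurable_fun setT (fun p : R * R => laplace_defect p.1 p.2).
Proof.
apply: measurable_funB => //; apply: measurableT_comp => //.
apply: measurableT_comp => //; apply: measurable_funM; apply: measurable_maxr => //.
Qed.

End laplace_defect.

(** * The averaged defect q and its behaviour *)

(** When the kernel represents [phi], this is 1 - phi(xi, u) for u >= 0. *)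
Definition kernel_defect d (X : measurableType d) (R : realType) (m : R.-pker X ~> R)
    (xi : X) (u : R) : \bar R := \int[m xi]_x (laplace_defect u x)%:E.

(* Locked because unification of two values would unfold the integrals. *)
HB.lock Definition mean_defect d (X : measurableType d) (R : realType)
    (tau : probability X R) (m : R.-pker X ~> R) (u : R) : R :=
  fine (\int[tau]_xi kernel_defect m xi u).

Section mean_defect.
Context d (X : measurableType d) (R : realType) (tau : probability X R) (m : R.-pker X ~> R).

Local Notation kernel_defect := (kernel_defect m).

Local Notation mean_defect := (mean_defect tau m).

Let mdef (u : R) : measurable_fun setT (laplace_defect u : R -> R).
Proof. exact: (measurable_fun_pair2 _ (@measurable_laplace_defect R)). Qed.

Let mdefect u : measurable_fun setT (fun x : R => (laplace_defect u x)%:E).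
Proof. by apply/measurable_EFinP; exact: mdef. Qed.

Lemma kernel_defect_ge0 xi u : 0 <= kernel_defect xi u.
Proof. by apply: integral_ge0 => x _; rewrite lee_fin laplace_defect_ge0. Qed.

Lemma kernel_defect_le1 xi u : kernel_defect xi u <= 1.
Proof.
apply: (@le_trans _ _ (\int[m xi]_x cst 1 x)).
  by apply: ge0_le_integral => // x _; rewrite lee_fin ?laplace_defect_ge0 ?laplace_defect_le1.
by rewrite integral_cst// mul1e prob_kernel.
Qed.

Lemma kernel_defect0 xi : kernel_defect xi 0 = 0.
Proof. by apply: integral0_eq => x _; rewrite laplace_defect0. Qed.

Lemma measurable_kernel_defect :
  measurable_fun setT (fun p : X * R => kernel_defect p.1 p.2).
Proof.
pose k := kpullback m (@measurable_fst _ _ X R).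
have mk : measurable_fun setT (fun p : (X * R) * R => (laplace_defect p.1.2 p.2)%:E).
  have mg : measurable_fun setT (fun p : (X * R) * R => (p.1.2, p.2)).
    by apply: measurable_fun_pair => //; exact: measurableT_comp.
  by apply/measurable_EFinP; exact: (measurableT_comp (@measurable_laplace_defect R) mg).
have := measurable_fun_integral_finite_kernel _ k _ mk.
by apply=> z; rewrite lee_fin laplace_defect_ge0.
Qed.

Lemma measurable_kernel_defect1 u : measurable_fun setT (kernel_defect ^~ u).
Proof. exact: (measurable_fun_pair1 _ measurable_kernel_defect). Qed.

Let intdefect_le1 u : \int[tau]_xi kernel_defect xi u <= 1.
Proof.
apply: (@le_trans _ _ (\int[tau]_xi cst 1 xi)).
  apply: ge0_le_integral => //.
  - by move=> xi _; exact: kernel_defect_ge0.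
  - exact: measurable_kernel_defect1.
  - by move=> xi _; exact: kernel_defect_le1.
by rewrite integral_cst// mul1e probability_le1.
Qed.

Let intdefect_ge0 u : 0 <= \int[tau]_xi kernel_defect xi u.
Proof. by apply: integral_ge0 => xi _; exact: kernel_defect_ge0. Qed.

Lemma mean_defectE u : (mean_defect u)%:E = \int[tau]_xi kernel_defect xi u.
Proof.
rewrite mean_defect.unlock fineK// ge0_fin_numE//.
by rewrite (le_lt_trans (intdefect_le1 u))// ltry.
Qed.

Lemma mean_defect_ge0 u : (0 <= mean_defect u)%R.
Proof. by rewrite -lee_fin mean_defectE. Qed.

Lemma mean_defect_le1 u : (mean_defect u <= 1)%R.
Proof. by rewrite -lee_fin mean_defectE. Qed.

Lemma mean_defect0 : mean_defect 0 = 0%R.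
Proof.
by apply: EFin_inj; rewrite mean_defectE integral0_eq// => xi _; exact: kernel_defect0.
Qed.

Let mI (F : R -> R) : measurable_fun setT F -> (forall x, 0 <= F x)%R ->
  measurable_fun setT (fun xi => \int[m xi]_x (F x)%:E).
Proof.
move=> /measurable_EFinP mF F0.
have F0' x : 0 <= (F x)%:E by rewrite lee_fin.
exact: (measurable_fun_integral_kernel (measurable_kernel m) F0' mF).
Qed.

Let le_intdefect (F G : R -> R) (mF : measurable_fun setT F) (mG : measurable_fun setT G) :
  (forall x, 0 <= F x)%R -> (forall x, F x <= G x)%R ->
  \int[tau]_xi \int[m xi]_x (F x)%:E <= \int[tau]_xi \int[m xi]_x (G x)%:E.
Proof.
move=> F0 FG; have G0 x : (0 <= G x)%R by rewrite (le_trans (F0 x)).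
apply: ge0_le_integral => //.
- by move=> xi _; apply: integral_ge0 => x _; rewrite lee_fin.
- exact: mI.
- exact: mI.
- move=> xi _; apply: ge0_le_integral => //.
  + by move=> x _; rewrite lee_fin.
  + exact/measurable_EFinP.
  + exact/measurable_EFinP.
  + by move=> x _; rewrite lee_fin.
Qed.

Lemma mean_defect_homo u v : (u <= v)%R -> (mean_defect u <= mean_defect v)%R.
Proof.
move=> uv; rewrite -lee_fin (mean_defectE u) (mean_defectE v).
apply: (@le_intdefect (laplace_defect u) (laplace_defect v)) => // x.
  exact: laplace_defect_ge0.
exact: laplace_defect_homo.
Qed.

Lemma measurable_mean_defect : measurable_fun setT mean_defect.
Proof. by apply: nondecreasing_measurable => // u v; exact: mean_defect_homo. Qed.

Let scale_intdefect (F : R -> R) (c : R) : measurable_fun setT F ->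
  (forall x, 0 <= F x)%R -> (0 <= c)%R ->
  \int[tau]_xi \int[m xi]_x (F x * c)%:E = (\int[tau]_xi \int[m xi]_x (F x)%:E) * c%:E.
Proof.
move=> mF F0 c0; rewrite -ge0_integralZr//; last 2 first.
- exact: mI.
- by move=> xi _; apply: integral_ge0 => x _; rewrite lee_fin.
apply: eq_integral => xi _.
under eq_integral do rewrite EFinM.
rewrite ge0_integralZr//; first exact/measurable_EFinP.
by move=> x _; rewrite lee_fin.
Qed.

Lemma mean_defect_concave u v : (0 < u)%R -> (u <= v)%R ->
  (mean_defect v * u <= mean_defect u * v)%R.
Proof.
move=> u0 uv; have v0 := lt_le_trans u0 uv.
rewrite -lee_fin 2!EFinM (mean_defectE u) (mean_defectE v).
rewrite -[leLHS](@scale_intdefect (laplace_defect v) u)//; last 2 first.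
- exact: laplace_defect_ge0.
- exact: ltW.
rewrite -[leRHS](@scale_intdefect (laplace_defect u) v)//; last 2 first.
- exact: laplace_defect_ge0.
- exact: ltW.
apply: (@le_intdefect (fun x => laplace_defect v x * u)%R (fun x => laplace_defect u x * v)%R).
- exact: measurable_funM.
- exact: measurable_funM.
- by move=> x; rewrite mulr_ge0 ?laplace_defect_ge0 ?(ltW u0).
- by move=> x; exact: laplace_defect_concave.
Qed.

Hypothesis mean1 : \int[tau]_xi \int[m xi]_(x in `[0%R, +oo[) x%:E = 1.

Let mean1' : \int[tau]_xi \int[m xi]_x (Num.max x 0)%:E = 1.
Proof.
rewrite -mean1; apply: eq_integral => xi _; rewrite [RHS]integral_mkcond.
apply: eq_integral => x _; rewrite patchE mem_setE in_itv/= andbT.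
by case: leP.
Qed.

Let mmax0 : measurable_fun setT (fun x : R => Num.max x 0)%R.
Proof. exact: measurable_maxr. Qed.

Let max0_ge0 (x : R) : (0 <= Num.max x 0)%R.
Proof. by rewrite le_max lexx orbT. Qed.

Lemma mean_defect_le u : (0 <= u)%R -> (mean_defect u <= u)%R.
Proof.
move=> u0; rewrite -lee_fin mean_defectE -[leRHS]mul1e -mean1'.
rewrite -[leRHS](@scale_intdefect (fun x => Num.max x 0)%R u)//.
apply: (@le_intdefect (laplace_defect u) (fun x => Num.max x 0 * u)%R) => //.
- exact: measurable_funM.
- exact: laplace_defect_ge0.
- by move=> x; rewrite mulrC laplace_defect_le.
Qed.

(** As n grows, n (1 - e^(-x/n)) increases to x, so n q(1/n) tends to the mean 1 by monotone
    convergence; some u = 1/n is the witness. *)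
Lemma mean_defect_near0 (e : R) : (0 < e)%R ->
  exists2 u : R, (0 < u)%R & ((1 - e) * u < mean_defect u)%R.
Proof.
move=> e0.
pose g (n : nat) (x : R) : R := (laplace_defect n.+1%:R^-1 x * n.+1%:R)%R.
have mg n : measurable_fun setT (g n) by exact: measurable_funM.
have g0 n x : (0 <= g n x)%R by rewrite mulr_ge0// laplace_defect_ge0.
have gnd x : {homo g^~ x : n k / (n <= k)%N >-> (n <= k)%R}.
  move=> n k nk; rewrite /g.
  have := @laplace_defect_concave R k.+1%:R^-1 n.+1%:R^-1 x.
  rewrite invr_gt0 ltr0n lef_pV2 ?posrE ?ltr0n// ler_nat ltnS => /(_ isT nk).
  by rewrite ler_pdivrMr ?ltr0n// mulrAC ler_pdivlMr ?ltr0n.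
have gcvg x : (g n x)%:E @[n --> \oo] --> (Num.max x 0)%:E.
  apply: cvg_EFin; first exact: nearW.
  set z := (Num.max x 0)%R.
  apply: (@squeeze_cvgr _ _ _ _ (fun n => z - z ^+ 2 * n.+1%:R^-1)%R (cst z)).
  - apply: nearW => n; rewrite /g; apply/andP; split.
      have := @laplace_defect_ge R n.+1%:R^-1 x.
      rewrite invr_ge0 ler0n => /(_ isT); rewrite -/z.
      rewrite -(ler_pM2r (x := n.+1%:R)) ?ltr0n//; apply: le_trans.
      rewrite le_eqVlt; apply/orP; left; apply/eqP; field.
      by rewrite addrC natr1 pnatr_eq0.
    rewrite -ler_pdivlMr ?ltr0n// mulrC laplace_defect_le// invr_ge0//.
  - rewrite -[X in _ --> X]subr0; apply: cvgB; first exact: cvg_cst.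
    rewrite -(mulr0 (z ^+ 2)%R); apply: cvgM; first exact: cvg_cst.
    exact: cvg_harmonic.
  - exact: cvg_cst.
have cI : (\int[tau]_xi \int[m xi]_x (g n x)%:E) @[n --> \oo] --> 1.
  (* Writing the iterated integral as one against the annealed law lets monotone convergence be
     applied only once. *)
  have annE (F : R -> R) : measurable_fun setT F -> (forall x, 0 <= F x)%R ->
      \int[tau]_xi \int[m xi]_x (F x)%:E = \int[annealed tau m]_p (F p.2)%:E.
    move=> mF F0; rewrite integral_annealed//.
      by apply/measurable_EFinP; exact: measurableT_comp.
    by move=> p; rewrite lee_fin.
  rewrite -mean1' annE//.
  under eq_cvg do rewrite annE//.
  have <- : \int[annealed tau m]_p limn (fun n => (g n p.2)%:E) =
      \int[annealed tau m]_p (Num.max p.2 0)%:E.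
    by apply: eq_integral => p _; apply/cvg_lim => //; exact: gcvg.
  apply: cvg_monotone_convergence => //.
  - by move=> n; apply/measurable_EFinP; exact: measurableT_comp.
  - by move=> n p _; rewrite lee_fin.
  - by move=> p _ n k nk; rewrite lee_fin gnd.
have cq : (mean_defect n.+1%:R^-1 * n.+1%:R)%R @[n --> \oo] --> (1%R : R).
  apply: (fine_cvg (f := fun n => (mean_defect n.+1%:R^-1 * n.+1%:R)%:E)).
  suff -> : (fun n => (mean_defect n.+1%:R^-1 * n.+1%:R)%:E) =
      (fun n => \int[tau]_xi \int[m xi]_x (g n x)%:E) by exact: cI.
  apply/funext => n; rewrite EFinM mean_defectE; apply/esym.
  apply: (@scale_intdefect (laplace_defect n.+1%:R^-1) n.+1%:R) => //.
  exact: laplace_defect_ge0.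
have e1 : (1 - e < 1)%R by rewrite gtrBl.
have [n _ /(_ n (leqnn _)) /= hn] := cvgr_gt _ cq _ e1.
exists n.+1%:R^-1%R; first by rewrite invr_gt0 ltr0n.
by rewrite ltr_pdivrMr ?ltr0n.
Qed.

End mean_defect.

(** * Admissible sequences and truncated sums of defects *)

Lemma measurable_nneg_ultimately_zero (R : realType) :
  measurable (nneg_ultimately_zero R).
Proof.
have mcoord i (B : set R) : measurable B -> measurable [set s : seqspace R | B (s i)].
  by move=> mB; rewrite -[X in measurable X]setTI; exact: measurable_coord.
rewrite (_ : nneg_ultimately_zero R =
    \bigcap_i [set s : seqspace R | `[0%R, +oo[%classic (s i)] `&`
    \bigcup_N \bigcap_i [set s : seqspace R | (N <= i)%N -> [set 0%R] (s i)]).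
  apply: measurableI; first by apply: bigcapT_measurable => i; exact: mcoord.
  apply: bigcupT_measurable => N; apply: bigcapT_measurable => i.
  have [Ni|iN] := leqP N i.
    rewrite (_ : [set s | _] = [set s : seqspace R | [set 0%R] (s i)]); first exact: mcoord.
    by apply/seteqP; split => s /=; [apply|move=> + _].
  rewrite (_ : [set s | _] = setT)//.
  by apply/seteqP; split => // s _ /= Ni; move: iN; rewrite ltnNge Ni.
apply/seteqP; split => [s [s0 [N sN]]|s [s0 [N _ sN]]]; split.
- by move=> i _ /=; rewrite in_itv/= s0.
- by exists N => // i _ /=; exact: sN.
- by move=> i; have := s0 i I; rewrite /= in_itv/= andbT.
- by exists N => i; exact: sN.
Qed.

(** Induction on 1 - Pp = (1 - P) + P(1 - p) with P <= 1. *)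
Lemma one_sub_prod_le (R : realDomainType) (n : nat) (p : nat -> R) :
  (forall i, 0 <= p i <= 1)%R -> (1 - \prod_(i < n) p i <= \sum_(i < n) (1 - p i))%R.
Proof.
move=> p01; have prod01 k : (0 <= \prod_(i < k) p i <= 1)%R.
  apply/andP; split; first by apply: prodr_ge0 => i _; case/andP: (p01 i).
  by apply: prodr_ile1 => i _; exact: p01.
elim: n => [|n ih]; first by rewrite !big_ord0 subrr.
rewrite !big_ord_recr /=; have /andP[_ pn] := p01 n; have /andP[P0 P1] := prod01 n.
by apply: (le_trans _ (lerD ih (lexx _))); nra.
Qed.

Section defect_sum.
Context d (X : measurableType d) (R : realType) (m : R.-pker X ~> R).

(** An upper bound for 1 minus the product of the phi(xi, u s_i). The truncation at 1 is what the
    heavy-tailed case relies on. *)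
Definition defect_sum (u : R) (p : X * seqspace R) : \bar R :=
  mine 1 (\sum_(0 <= i <oo) kernel_defect m p.1 (u * p.2 i)%R).

Lemma defect_sum_ge0 u p : 0 <= defect_sum u p.
Proof.
rewrite le_min lee01/=; apply: nneseries_ge0 => i _ _.
exact: kernel_defect_ge0.
Qed.

Lemma defect_sum_le1 u p : defect_sum u p <= 1.
Proof. by rewrite ge_min lexx. Qed.

Lemma measurable_defect_sum u : measurable_fun setT (defect_sum u).
Proof.
apply: measurable_mine => //; apply: ge0_emeasurable_sum => i.
  by move=> *; exact: kernel_defect_ge0.
move=> _; apply: (measurableT_comp (measurable_kernel_defect m)
  (g := fun p : X * seqspace R => (p.1, u * p.2 i)%R)).
apply: measurable_fun_pair => //; apply: measurable_funM => //.
exact: (measurableT_comp (@measurable_coord _ _ i)).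
Qed.

(* Jensen's inequality for the concave function [min 1]. *)
Lemma integral_defect_sum_le (tau : probability X R) (u : R) (s : seqspace R) :
  \int[tau]_xi defect_sum u (xi, s) <=
    mine 1 (\sum_(0 <= i <oo) (mean_defect tau m (u * s i))%:E).
Proof.
have mds : measurable_fun setT (fun xi => defect_sum u (xi, s)).
  exact: (measurable_fun_pair1 _ (measurable_defect_sum u)).
rewrite le_min; apply/andP; split.
  apply: (@le_trans _ _ (\int[tau]_xi cst 1 xi)).
    apply: ge0_le_integral => // xi _; first exact: defect_sum_ge0.
    exact: defect_sum_le1.
  by rewrite integral_cst// mul1e probability_le1.
under eq_eseriesr do rewrite mean_defectE.
rewrite -integral_nneseries//; last 2 first.
- by move=> i; exact: measurable_kernel_defect1.
- by move=> i xi _; exact: kernel_defect_ge0.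
apply: ge0_le_integral => //.
- by move=> xi _; exact: defect_sum_ge0.
- apply: ge0_emeasurable_sum => i; first by move=> *; exact: kernel_defect_ge0.
  by move=> _; exact: measurable_kernel_defect1.
- by move=> xi _; rewrite ge_min lexx orbT.
Qed.

End defect_sum.

Lemma kernel_defectE d (X : measurableType d) (R : realType) (m : R.-pker X ~> R)
    (xi : X) (u v : R) : (0 <= u)%R -> m xi `[0%R, +oo[%classic = 1 ->
  v%:E = \int[m xi]_(x in `[0%R, +oo[) (expR (- (u * x)))%:E ->
  kernel_defect m xi u = (1 - v)%:E.
Proof.
move=> u0 m1 vE.
have kE : kernel_defect m xi u = \int[m xi]_(x in `[0%R, +oo[) (laplace_defect u x)%:E.
  rewrite [RHS]integral_mkcond; apply: eq_integral => x _.
  rewrite patchE mem_setE in_itv/= andbT; case: leP => // x0.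
  by rewrite /laplace_defect (max_idPr (ltW x0)) mulr0 oppr0 expR0 subrr.
have : v%:E + kernel_defect m xi u = 1.
  have mE : measurable_fun (`[0%R, +oo[%classic : set R) (fun x : R => (expR (- (u * x)))%:E).
    apply/measurable_EFinP/measurable_funTS; apply: measurableT_comp => //.
    by apply: measurableT_comp => //; exact: measurable_funM.
  have mD : measurable_fun (`[0%R, +oo[%classic : set R) (fun x : R => (laplace_defect u x)%:E).
    apply/measurable_EFinP/measurable_funTS.
    exact: (measurable_fun_pair2 _ (@measurable_laplace_defect R)).
  rewrite vE kE -ge0_integralD; [|by []|by move=> x _; rewrite lee_fin expR_ge0|by []
    |by move=> x _; rewrite lee_fin laplace_defect_ge0|by []].
  rewrite -[RHS]m1 -[RHS]mul1e -integral_cst//; apply: eq_integral => x.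
  rewrite inE/= in_itv/= andbT => x0.
  by rewrite laplace_defectE// -EFinD addrC subrK.
move=> vk; have fk : kernel_defect m xi u \is a fin_num.
  by rewrite ge0_fin_numE ?kernel_defect_ge0// (le_lt_trans (kernel_defect_le1 _ _ _))// ltry.
by rewrite EFinB -vk addeAC subee// add0e.
Qed.

Lemma prob_kernel_setC d d' (X : measurableType d) (Y : measurableType d') (R : realType)
    (k : R.-pker X ~> Y) (x : X) (A : set Y) : measurable A ->
  k x A = 1 -> k x (~` A) = 0.
Proof.
move=> mA kA; have : 1 + k x (~` A) = 1.
  rewrite -[in LHS]kA -[RHS](@prob_kernel _ _ _ _ _ k x) -(setUv A) measureU//.
    exact: measurableC.
  exact: setICr.
by case: (k x (~` A)) => [r||]//; rewrite -EFinD => -[] h; congr EFin; lra.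
Qed.

Section kernel_prob.
Context d d' (X : measurableType d) (Y : measurableType d') (R : realType)
  (k : R.-pker X ~> Y) (x : X).

(** Naming [k x] gives it a probability structure, for the exchange of integrals in
    [mean_defect_sub]. *)
Definition kernel_prob : set Y -> \bar R := k x.

HB.instance Definition _ := Measure.on kernel_prob.

Let kernel_prob_setT : kernel_prob setT = 1.
Proof. exact: prob_kernel. Qed.

HB.instance Definition _ := Measure_isProbability.Build _ _ _ kernel_prob kernel_prob_setT.

End kernel_prob.

(** * From the functional equation to an inequality for q *)

Section functional_equation.
Context (R : realType) (d : measure_display) (Theta : measurableType d)
  (tau : probability (seqspace Theta) R) (eta : R.-pker Theta ~> seqspace R)
  (d' : measure_display) (Omega : measurableType d')
  (P : R.-pker (seqspace Theta) ~> Omega)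
  (y : nat -> (seqspace Theta * Omega)%type -> R).
Hypotheses (iid_tau : iid tau) (eta_supp : forall t, eta t (nneg_ultimately_zero R) = 1)
  (meas_y : forall i, measurable_fun setT (y i))
  (law_y : forall xi (A : set (seqspace R)), measurable A ->
    P xi [set w | A (fun i => y i (xi, w))] = eta (xi 0%N) A).

Definition yseq (z : seqspace Theta * Omega) : seqspace R := fun i => y i z.

Let measurable_yseq : measurable_fun setT yseq.
Proof. exact: measurable_fun_seqspace. Qed.

Let measurable_yseq1 xi : measurable_fun setT (fun w => yseq (xi, w)).
Proof. exact: (measurable_fun_pair2 _ measurable_yseq). Qed.

Let ylaw xi (G : seqspace R -> \bar R) : measurable_fun setT G -> (forall s, 0 <= G s) ->
  \int[P xi]_w G (yseq (xi, w)) = \int[eta (xi 0%N)]_s G s.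
Proof.
move=> mG G0.
transitivity (\int[pushforward (P xi) (fun w => yseq (xi, w))]_s G s).
  rewrite (ge0_integral_pushforward (measurable_yseq1 xi) _ measurableT mG); last by move=> s _.
  by [].
by apply: eq_measure_integral => A mA _; exact: law_y.
Qed.

Lemma yseq_good xi : {ae P xi, forall w, nneg_ultimately_zero R (yseq (xi, w))}.
Proof.
have mnuz := @measurable_nneg_ultimately_zero R.
have mS : measurable [set w | nneg_ultimately_zero R (yseq (xi, w))].
  by rewrite -[X in measurable X]setTI; exact: measurable_yseq1.
exists (~` [set w | nneg_ultimately_zero R (yseq (xi, w))]); split => //.
- exact: measurableC.
- by rewrite (@prob_kernel_setC _ _ _ _ _ P)// law_y.
Qed.

Lemma annealed_good : {ae annealed tau P, forall z, nneg_ultimately_zero R (yseq z)}.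
Proof.
have mnuz := @measurable_nneg_ultimately_zero R.
have mS : measurable [set z | nneg_ultimately_zero R (yseq z)].
  by rewrite -[X in measurable X]setTI; exact: measurable_yseq.
exists (~` [set z | nneg_ultimately_zero R (yseq z)]); split => //.
  exact: measurableC.
apply: integral0_eq => xi _.
rewrite (_ : xsection _ xi = ~` [set w | nneg_ultimately_zero R (yseq (xi, w))]).
  have mS1 : measurable [set w | nneg_ultimately_zero R (yseq (xi, w))].
    by rewrite -[X in measurable X]setTI; exact: measurable_yseq1.
  by rewrite (@prob_kernel_setC _ _ _ _ _ P)// law_y.
by apply/seteqP; split => w; rewrite /xsection/= inE.
Qed.

Variables (phi : seqspace Theta -> R -> R) (m : R.-pker (seqspace Theta) ~> R).
Hypothesis m_supp : forall xi, m xi `[0%R, +oo[%classic = 1.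
Hypothesis phiE : forall xi (u : R), (0 <= u)%R ->
  (phi xi u)%:E = \int[m xi]_(x in `[0%R, +oo[) (expR (- (u * x)))%:E.
Hypothesis phi_eq : forall u : R, (0 <= u)%R -> {ae tau, forall xi,
  (phi xi u)%:E = \int[P xi]_w (limn (fun n =>
    (\prod_(i < n) phi (env_shift xi) (u * y i (xi, w)))%R))%:E}.

Let defectE xi u : (0 <= u)%R -> kernel_defect m xi u = (1 - phi xi u)%:E.
Proof. by move=> u0; apply: kernel_defectE => //; exact: phiE. Qed.

Let phi01 xi u : (0 <= u)%R -> (0 <= phi xi u <= 1)%R.
Proof.
move=> u0; have := kernel_defect_ge0 m xi u; have := kernel_defect_le1 m xi u.
by rewrite defectE// !lee_fin => a b; apply/andP; split; lra.
Qed.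

(** Beyond [N] the factors are phi(T xi, 0) = 1, so the limit is a finite product, to which
    [one_sub_prod_le] applies. *)
Let lim_prod_ge xi u w : (0 <= u)%R -> nneg_ultimately_zero R (yseq (xi, w)) ->
  1 - defect_sum m u (env_shift xi, yseq (xi, w)) <=
  (limn (fun n => (\prod_(i < n) phi (env_shift xi) (u * y i (xi, w)))%R))%:E.
Proof.
move=> u0 [y0 [N yN]].
pose p i := phi (env_shift xi) (u * y i (xi, w))%R.
have uy0 i : (0 <= u * y i (xi, w))%R by rewrite mulr_ge0//; exact: y0.
have p01 i : (0 <= p i <= 1)%R by exact: phi01.
have pN i : (N <= i)%N -> p i = 1%R.
  move=> /yN; rewrite /yseq /p => ->; rewrite mulr0.
  have := defectE (env_shift xi) (lexx 0); rewrite kernel_defect0 => -[]; lra.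
have -> : limn (fun n => (\prod_(i < n) p i)%R) = (\prod_(i < N) p i)%R.
  apply/cvg_lim => //; apply: cvg_near_cst; near=> n.
  have Nn : (N <= n)%N by near: n; exact: nbhs_infty_ge.
  rewrite -!(big_mkord xpredT p) (@big_cat_nat _ _ _ N)//=.
  rewrite [X in (_ * X)%R]big_nat_cond [X in (_ * X)%R]big1 ?mulr1//.
  by move=> i /andP[/andP[Ni _] _]; exact: pN.
rewrite /defect_sum /= (_ : \sum_(0 <= i <oo) _ = (\sum_(i < N) (1 - p i))%:E); last first.
  rewrite (eq_eseriesr (g := fun i => (1 - p i)%:E)); last first.
    by move=> i _; apply: defectE; exact: uy0.
  by apply: (@eseries_EFin_finsupp R (fun i => 1 - p i)%R N) => i /pN ->; rewrite subrr.
rewrite -EFin_min -EFinB lee_fin lerBlDr -lerBlDl le_min.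
rewrite one_sub_prod_le// andbT gerBl; apply: prodr_ge0 => i _.
by case/andP: (p01 i).
Unshelve. all: by end_near. Qed.

Let mdefect_yseq u xi :
  measurable_fun setT (fun w => defect_sum m u (env_shift xi, yseq (xi, w))).
Proof.
exact: (measurableT_comp (measurable_fun_pair2 _ (measurable_defect_sum m u))
  (measurable_yseq1 xi)).
Qed.

Lemma kernel_defect_sub u : (0 <= u)%R -> {ae tau, forall xi,
  kernel_defect m xi u <= \int[P xi]_w defect_sum m u (env_shift xi, yseq (xi, w))}.
Proof.
move=> u0; apply: filterS (phi_eq u0) => xi phiE_xi.
set D := fun w => defect_sum m u (env_shift xi, yseq (xi, w)).
have D0 w : 0 <= D w by exact: defect_sum_ge0.
have D1 w : D w <= 1 by exact: defect_sum_le1.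
have mD : measurable_fun setT D by exact: mdefect_yseq.
pose L w : \bar R := (limn (fun n =>
  (\prod_(i < n) phi (env_shift xi) (u * y i (xi, w)))%R))%:E.
(* Off the good sequences nothing is known of the limit. The default 1 there changes the integrand
   on a null set and keeps it above [1 - D w]. *)
pose L' w : \bar R := if pselect (nneg_ultimately_zero R (yseq (xi, w))) then L w else 1.
have L'E : \int[P xi]_w L w = \int[P xi]_w L' w.
  apply: ae_eq_integral_any; apply: filterS (yseq_good xi) => w gw.
  by rewrite /L'; case: pselect.
have fD w : D w \is a fin_num by rewrite ge0_fin_numE// (le_lt_trans (D1 w))// ltry.
have L'_ge w : 1 - D w <= L' w.
  rewrite /L'; case: pselect => [gw|ngw] /=; first exact: lim_prod_ge.
  by rewrite leeBlDr ?fD// leeDl.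
have BD0 w : 0 <= 1 - D w by rewrite sube_ge0 ?D1 ?fD ?orbT.
have : \int[P xi]_w (1 - D w) <= (phi xi u)%:E.
  rewrite phiE_xi -/L L'E; apply: ae_ge0_le_integral_any => //.
    by move=> w; rewrite (le_trans (BD0 w)).
  exact: aeW.
have : \int[P xi]_w (1 - D w) + \int[P xi]_w D w = 1.
  rewrite -ge0_integralD//; last by apply: emeasurable_funB.
  rewrite (eq_integral (cst 1)); last by move=> w _; rewrite subeK.
  by rewrite integral_cst// mul1e prob_kernel.
rewrite defectE// EFinB => E le1.
by rewrite leeBlDr// -E addeC leeD2l.
Qed.

(* Given xi, the law of the y_i depends on xi_0 only, and the factors
   phi (T xi) depend on the shifted environment only: they are independent. *)
Lemma mean_defect_sub u : (0 <= u)%R ->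
  (mean_defect tau m u)%:E <= \int[annealed tau P]_z
    mine 1 (\sum_(0 <= i <oo) (mean_defect tau m (u * y i z))%:E).
Proof.
move=> u0; pose Psi := defect_sum m u.
have mPsi : measurable_fun setT Psi := measurable_defect_sum m u.
have Psi0 p : 0 <= Psi p := defect_sum_ge0 m u p.
pose M (s : seqspace R) := mine 1 (\sum_(0 <= i <oo) (mean_defect tau m (u * s i))%:E).
have M0 s : 0 <= M s.
  by rewrite le_min lee01/=; apply: nneseries_ge0 => i _ _; rewrite lee_fin mean_defect_ge0.
have mM : measurable_fun setT M.
  apply: measurable_mine => //; apply: ge0_emeasurable_sum => [i s _ _|i _].
    by rewrite lee_fin mean_defect_ge0.
  apply/measurable_EFinP.
  have mus : measurable_fun setT (fun s : seqspace R => u * s i)%R.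
    by apply: measurable_funM => //; exact: measurable_coord.
  exact: (measurableT_comp (measurable_mean_defect tau m) mus).
(* The first environment coordinate and the shift enter as separate variables, as
   [integral_iid_split] requires. *)
pose G (p : Theta * seqspace Theta) := \int[eta p.1]_s Psi (p.2, s).
have G0 p : 0 <= G p by apply: integral_ge0.
have mG : measurable_fun setT G.
  pose k := kpullback eta (@measurable_fst _ _ Theta (seqspace Theta)).
  have mg : measurable_fun setT
      (fun p : (Theta * seqspace Theta) * seqspace R => (p.1.2, p.2)).
    by apply: measurable_fun_pair => //; exact: measurableT_comp.
  exact: (measurable_fun_integral_finite_kernel _ k
    (fun z => Psi0 _) (measurableT_comp mPsi mg)).
have mGxi : measurable_fun setT (fun xi : seqspace Theta => G (xi 0%N, env_shift xi)).
  have ms : measurable_fun setT (fun xi : seqspace Theta => (xi 0%N, env_shift xi)).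
    by apply: measurable_fun_pair; [exact: measurable_coord|exact: measurable_env_shift].
  exact: (measurableT_comp mG ms).
rewrite mean_defectE.
have GE xi : \int[P xi]_w defect_sum m u (env_shift xi, yseq (xi, w)) =
    G (xi 0%N, env_shift xi).
  apply: (@ylaw xi (fun s => Psi (env_shift xi, s))) => //.
  exact: (measurable_fun_pair2 _ mPsi).
apply: (@le_trans _ _ (\int[tau]_xi G (xi 0%N, env_shift xi))).
  apply: ae_ge0_le_integral => //.
  - by move=> xi _; exact: kernel_defect_ge0.
  - exact: measurable_kernel_defect1.
  - by apply: filterS (kernel_defect_sub u0) => xi h _; rewrite -GE.
rewrite integral_iid_split//.
have -> : \int[annealed tau P]_z M (yseq z) = \int[tau]_xi \int[eta (xi 0%N)]_s M s.
  rewrite integral_annealed//; last exact: (measurableT_comp mM measurable_yseq).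
  by apply: eq_integral => xi _; exact: ylaw.
have mEM : measurable_fun setT (fun xi : seqspace Theta => \int[eta (xi 0%N)]_s M s).
  have mMe : measurable_fun setT (fun t => \int[eta t]_s M s).
    exact: (measurable_fun_integral_kernel (measurable_kernel eta) M0 mM).
  exact: (measurableT_comp mMe (measurable_coord 0%N)).
apply: ge0_le_integral => //.
- by move=> xi _; apply: integral_ge0.
- have mF : measurable_fun setT (fun t => \int[tau]_x' G (t, x')).
    exact: measurable_fun_fubini_tonelli_F.
  exact: (measurableT_comp mF (measurable_coord 0%N)).
move=> xi _.
(* Exchanging the integrals fixes the sequence [s] while the environment is averaged, so that
   [integral_defect_sum_le] applies. *)
have -> : \int[tau]_x' G (xi 0%N, x') =
    \int[eta (xi 0%N)]_s \int[tau]_x' Psi (x', s).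
  exact: (@fubini_tonelli _ _ _ _ _ tau (kernel_prob eta (xi 0%N)) Psi).
apply: ge0_le_integral => //.
- by move=> s _; apply: integral_ge0.
- exact: measurable_fun_fubini_tonelli_G.
- by move=> s _; exact: integral_defect_sum_le.
Qed.

End functional_equation.

(** * Contradiction with the mean number of positive weights *)

(** The measure of the sections of an annealed null set is a nonnegative function of integral 0. *)
Lemma annealed_ae d d' (X : measurableType d) (Y : measurableType d') (R : realType)
    (tau : probability X R) (P : R.-pker X ~> Y) (Q : X * Y -> Prop) :
  {ae annealed tau P, forall z, Q z} -> {ae tau, forall x, {ae P x, forall w, Q (x, w)}}.
Proof.
move=> [N [mN N0 QN]].
have msec : measurable_fun setT (fun x => P x (xsection N x)).
  by apply: (measurable_fun_xsection_finite_kernel P); rewrite inE.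
have : ae_eq tau setT (fun x => P x (xsection N x)) (cst 0).
  apply/ae_eq_integral_abs => //; rewrite -[RHS]N0.
  by apply: eq_integral => x _; rewrite gee0_abs.
apply: filterS => x /(_ I) Px0; exists (xsection N x); split => //.
  exact: measurable_xsection.
by move=> w /= Qw; rewrite /xsection/= inE; exact: QN.
Qed.

Theorem theorem1p2 (R : realType)
  (d : measure_display) (Theta : measurableType d)
  (tau : probability (seqspace Theta) R)
  (eta : R.-pker Theta ~> seqspace R)
  (d' : measure_display) (Omega : measurableType d')
  (P : R.-pker (seqspace Theta) ~> Omega)
  (y : nat -> nat -> (seqspace Theta * Omega)%type -> R)
  (iid_tau : iid tau)
  (eta_supp : forall t, eta t (nneg_ultimately_zero R) = 1)
  (meas_y : forall n i, measurable_fun setT (y n i))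
  (law_y : forall n xi (A : set (seqspace R)), measurable A ->
    P xi [set w | A (fun i => y n i (xi, w))] = eta (xi n) A)
  (mean_one : forall n, {ae tau, forall xi,
    \int[P xi]_w (\sum_(0 <= i <oo) (y n i (xi, w))%:E) = 1})
  (finite_pos : forall n, {ae tau, forall xi,
    P xi [set w | \sum_(0 <= i <oo) ((0 < y n i (xi, w))%R%:R : R)%:E < +oo] = 1})
  (log_mean_pos : forall n,
    0 < \int[tau]_xi lne (\int[P xi]_w
          (\sum_(0 <= i <oo) ((0 < y n i (xi, w))%R%:R : R)%:E)))
  (ylogy_exists : integral_exists (annealed tau P)
    (fun z => \sum_(0 <= i <oo) (y 0%N i z * ln (y 0%N i z))%:E))
  (ylogy_ge0 : 0 <= \int[annealed tau P]_z
    (\sum_(0 <= i <oo) (y 0%N i z * ln (y 0%N i z))%:E)) :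
  ~ exists phi : seqspace Theta -> R -> R,
      class_L tau 1%R phi /\
      forall u : R, (0 <= u)%R -> {ae tau, forall xi,
        (phi xi u)%:E =
        \int[P xi]_w (limn (fun n =>
          (\prod_(i < n) phi (env_shift xi) (u * y 0%N i (xi, w)))%R))%:E}.
Proof.
move=> [phi [[m [m_supp mean1_m phiE]] phi_eq]].
have good_ae := annealed_good tau eta_supp (meas_y 0%N) (law_y 0%N).
have good_xi := yseq_good eta_supp (meas_y 0%N) (law_y 0%N).
have q_sub := mean_defect_sub iid_tau eta_supp (meas_y 0%N) (law_y 0%N) m_supp phiE phi_eq.
set good := fun z => nneg_ultimately_zero R (yseq (y 0%N) z) in good_ae good_xi.
pose G := [set z | good z].
have mG : measurable G.
  rewrite -[X in measurable X]setTI.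
  have my : measurable_fun setT (yseq (y 0%N)).
    by apply: measurable_fun_seqspace => i; exact: meas_y.
  exact: (my measurableT _ (@measurable_nneg_ultimately_zero R)).
(* Replacing bad sequences by zero makes nonnegativity and finite support hold everywhere, while
   integrals are unchanged because [good] is almost sure. *)
pose yt i z : R := (y 0%N i z * \1_G z)%R.
have yt_good i z : good z -> yt i z = y 0%N i z.
  by move=> gz; rewrite /yt indicE mem_set// mulr1.
have yt_bad i z : ~ good z -> yt i z = 0%R.
  by move=> gz; rewrite /yt indicE memNset// mulr0.
have myt i : measurable_fun setT (yt i).
  by apply: measurable_funM => //; exact: measurable_indic.
have yt0 i z : (0 <= yt i z)%R.
  have [gz|gz] := pselect (good z); last by rewrite yt_bad.
  by rewrite yt_good//; have [+ _] := gz; apply.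
have ytfin z : exists N, forall i, (N <= i)%N -> yt i z = 0%R.
  have [gz|gz] := pselect (good z); last by exists 0%N => i _; exact: yt_bad.
  by have [_ [N yN]] := gz; exists N => i Ni; rewrite yt_good//; exact: yN.
have sumyt : \int[annealed tau P]_z (\sum_(0 <= i <oo) (yt i z)%:E) = 1.
  rewrite integral_annealed; last 2 first.
  - apply: ge0_emeasurable_sum => [i z _ _|i _]; first by rewrite lee_fin.
    exact/measurable_EFinP.
  - by move=> z; apply: nneseries_ge0 => i _ _; rewrite lee_fin.
  rewrite (@ae_eq_integral_any _ _ _ tau _ (cst 1)).
    by rewrite integral_cst// mul1e; exact: probability_setT.
  apply: filterS (mean_one 0%N) => xi <-; apply: ae_eq_integral_any.
  apply: filterS (good_xi xi) => w gw.
  by apply: eq_eseriesr => i _; rewrite yt_good.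
have f_eq : {ae annealed tau P, forall z,
    \sum_(0 <= i <oo) (yt i z * ln (yt i z))%:E =
    \sum_(0 <= i <oo) (y 0%N i z * ln (y 0%N i z))%:E}.
  by apply: filterS good_ae => z gz; apply: eq_eseriesr => i _; rewrite yt_good.
have triv : {ae annealed tau P, forall z i, (yt i z * ln (yt i z) = 0)%R}.
  apply: (@smoothing_weights_trivial _ _ R (annealed tau P) yt (mean_defect tau m)) => //.
  - case: ylogy_exists => h; [left|right]; apply: le_lt_trans h;
      rewrite le_eqVlt; apply/orP; left; apply/eqP; apply: ae_eq_integral_any;
      by apply: filterS f_eq => z; rewrite !unlock => ->.
  - apply: (le_trans ylogy_ge0); rewrite le_eqVlt; apply/orP; left; apply/eqP/esym.
    exact: ae_eq_integral_any.
  - exact: measurable_mean_defect.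
  - exact: mean_defect0.
  - by move=> u _; exact: mean_defect_ge0.
  - by move=> u _; exact: mean_defect_le1.
  - by move=> u /ltW u0; exact: mean_defect_le.
  - by move=> u v; exact: mean_defect_concave.
  - by move=> e; exact: mean_defect_near0.
  - move=> u /ltW u0; apply: (le_trans (q_sub u u0)).
    rewrite le_eqVlt; apply/orP; left; apply/eqP; apply: ae_eq_integral_any.
    apply: filterS good_ae => z gz; congr (mine 1 _).
    by apply: eq_eseriesr => i _; rewrite yt_good.
(* Almost surely each weight is 0 or 1, so the number of positive weights equals their sum. Its
   quenched mean is 1, with logarithm 0. *)
have := log_mean_pos 0%N; rewrite (@ae_eq_integral_any _ _ _ tau _ (cst 0)).
  by rewrite integral_cst// mul0e ltxx.
apply: filterS2 (mean_one 0%N) (annealed_ae triv) => xi mean1_xi triv_xi.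
rewrite (_ : \int[P xi]_w _ = 1); first exact: lne1.
rewrite -mean1_xi; apply: ae_eq_integral_any.
apply: filterS2 (good_xi xi) triv_xi => w gw triv_w.
apply: eq_eseriesr => i _; congr EFin; rewrite -!(yt_good _ _ gw).
have := triv_w i; have := yt0 i (xi, w); rewrite le_eqVlt => /predU1P[<-|y0]; first by rewrite ltxx.
move=> /eqP; rewrite mulf_eq0 (gt_eqF y0)/= ln_eq0// => /eqP ->.
by rewrite ltr01.
Qed.
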